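(* Let $G$ be a locally finite graph. The following are equivalent: (i) $G$ is $3$-locally chordal (equivalently: $G$ is wheel-free). (ii) $G$ has a $3$-acyclic clique graph. (iii) $G$ has a $3$-acyclic canonical region representation. (iv) $G$ has a $3$-acyclic region representation.
   Context: All graphs are simple and possibly infinite; locally finite means every vertex has finite degree. A graph is chordal if each of its cycles of length at least $4$ has a chord. The ball $B_{3/2}(v)$ is the subgraph of $G$ whose vertices are those at distance at most $3/2$ from $v$ and whose edges are the edges of $G$ for which the sum of the distances of the endpoints to $v$ is strictly less than $3$ (so it is the subgraph induced on the closed neighborhood of $v$). $G$ is $3$-locally chordal if every ball $B_{3/2}(v)$ is chordal. A wheel $W_n$, $n\ge4$, consists of a cycle of length $n$ together with one further vertex adjacent to all vertices of the cycle; $G$ is wheel-free if no $W_n$ with $n\ge 4$ is an induced subgraph of $G$. A region of $H$ is a nonempty connected subgraph. A region representation of $G$ over a graph $H$ is a map $v\mapsto H_v$ assigning to each vertex of $G$ a region of $H$ such that, for distinct $u,v$, $uv\in E(G)$ iff $H_u\cap H_v\neq\emptyset$. It is $3$-acyclic if for every $X\subseteq V(G)$ with $|X|\le 3$ the union $\bigcup_{x\in X}H_x$ is acyclic. It is canonical if there is an action of $\mathrm{Aut}(G)$ on $H$ (by graph automorphisms) with $\gamma\cdot H_v=H_{\gamma(v)}$ for all $\gamma\in\mathrm{Aut}(G)$ and $v\in V(G)$. Let $K(G)$ be the set of inclusion-maximal cliques of $G$, $K_G(v)$ those containing $v$, and $\mathbf K(G)$ the graph on $K(G)$ in which two distinct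 maximal cliques are adjacent iff they intersect. A clique graph of $G$ is a spanning subgraph $H$ of $\mathbf K(G)$ such that $H[K_G(v)]$ is connected for every vertex $v$ of $G$ (equivalently, $v\mapsto H[K_G(v)]$ is a region representation of $G$ over $H$); it is $3$-acyclic if this region representation is. *)

(* Defs.v *)
From mathcomp Require Import all_boot.
From mathcomp Require Import boolp classical_sets cardinality.

Set Implicit Arguments.
Unset Strict Implicit.
Unset Printing Implicit Defensive.

#[local] Obligation Tactic := idtac.

Local Open Scope classical_set_scope.
Local Open Scope card_scope.

(* A possibly infinite simple graph; its vertex set is the whole type [T]. *)
Record graph (T : Type) := Graph {
  adj :> T -> T -> Prop;
  adj_sym : forall x y, adj x y -> adj y x;
  adj_irr : forall x, ~ adj x x
}.

(* Subgraphs need not be induced. *)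
Record subgraph (T : Type) (H : graph T) := Subgraph {
  sverts : set T;
  sedge : T -> T -> Prop;
  sedge_sym : forall x y, sedge x y -> sedge y x;
  sedge_vert : forall x y, sedge x y -> sverts x;
  sedge_adj : forall x y, sedge x y -> H x y
}.

Section Walks.
Variables (T : Type) (E : T -> T -> Prop).

Fixpoint walk (n : nat) (x y : T) : Prop :=
  if n is m.+1 then exists2 z, E x z & walk m z y else x = y.

Lemma walk_rcons n x y z : walk n x y -> E y z -> walk n.+1 x z.
Proof.
elim: n x => [|n IHn] x /=; first by move=> -> Eyz; exists z.
by case=> w Exw wy Eyz; exists w => //; exact: IHn.
Qed.

(* A distance is a natural number; [is_dist x y n] fails for every [n] when
   there is no walk from [x] to [y], i.e. when the distance is infinite. *)
Definition is_dist (x y : T) (n : nat) : Prop :=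
  walk n x y /\ forall m, walk m x y -> n <= m.

Definition is_cycle (n : nat) (c : 'I_n -> T) : Prop :=
  [/\ 3 <= n, injective c & forall i, E (c i) (c (ordS i))].

Definition has_chord (n : nat) (c : 'I_n -> T) : Prop :=
  exists i j : 'I_n, [/\ i <> j, j <> ordS i, i <> ordS j & E (c i) (c j)].

End Walks.

Section Subgraphs.
Variables (T : Type) (H : graph T).
Implicit Type S : subgraph H.

Definition connected S : Prop :=
  forall x y, sverts S x -> sverts S y -> exists n, walk (sedge S) n x y.

Definition acyclic S : Prop :=
  forall n (c : 'I_n -> T), ~ is_cycle (sedge S) c.

Definition chordal S : Prop :=
  forall n (c : 'I_n -> T), 4 <= n -> is_cycle (sedge S) c ->
    has_chord (sedge S) c.

Definition is_region S : Prop := sverts S !=set0 /\ connected S.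

Program Definition induced (A : set T) : subgraph H := {|
  sverts := A;
  sedge := fun x y => [/\ A x, A y & H x y]
|}.
Next Obligation. by move=> A x y [Ax Ay Hxy]; split=> //; exact: adj_sym. Qed.
Next Obligation. by move=> A x y []. Qed.
Next Obligation. by move=> A x y []. Qed.

Program Definition union_subgraph (I : Type) (X : set I)
    (R : I -> subgraph H) : subgraph H := {|
  sverts := \bigcup_(i in X) sverts (R i);
  sedge := fun x y => exists2 i, X i & sedge (R i) x y
|}.
Next Obligation. by move=> I X R x y [i Xi Exy]; exists i => //; exact: sedge_sym. Qed.
Next Obligation. by move=> I X R x y [i Xi Exy]; exists i => //; exact: sedge_vert Exy. Qed.
Next Obligation. by move=> I X R x y [i _ Exy]; exact: sedge_adj Exy. Qed.

Lemma half_ball_vert (r : nat) (v x y : T) :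
  H x y -> (exists a b, [/\ is_dist H v x a, is_dist H v y b & a + b < r]) ->
  exists2 a, is_dist H v x a & a.*2 <= r.
Proof.
move=> Hxy [a [b [dx dy ltabr]]]; exists a => //.
have lea : a <= b.+1 by apply: dx.2; apply: walk_rcons dy.1 (adj_sym Hxy).
rewrite -addnn (leq_trans _ ltabr) // -addnS leq_add2l //.
Qed.

(* The ball of radius r/2 around v, with both sides of the inequalities doubled
   where needed: its vertices x satisfy d(v,x) <= r/2 and its edges xy satisfy
   d(v,x) + d(v,y) < r. *)
Program Definition half_ball (r : nat) (v : T) : subgraph H := {|
  sverts := [set x | exists2 a, is_dist H v x a & a.*2 <= r];
  sedge := fun x y => H x y /\
    exists a b, [/\ is_dist H v x a, is_dist H v y b & a + b < r]
|}.
Next Obligation.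
move=> r v x y [Hxy [a [b [dx dy ltr]]]]; split; first exact: adj_sym.
by exists b, a; rewrite addnC.
Qed.
Next Obligation. by move=> r v x y [Hxy d]; exact: half_ball_vert Hxy d. Qed.
Next Obligation. by move=> r v x y []. Qed.

End Subgraphs.

Definition locally_finite (T : Type) (G : graph T) : Prop :=
  forall v, finite_set [set w | G v w].

Definition locally_chordal (r : nat) (T : Type) (G : graph T) : Prop :=
  forall v, chordal (half_ball G r v).

(* [None] is the hub of the wheel, [Some i] the i-th vertex of its rim. The
   conjunct [i <> j] is redundant for 2 <= n; it keeps the graph simple for
   n = 1. *)
Definition wheel_adj (n : nat) (x y : option 'I_n) : Prop :=
  match x, y with
  | Some i, Some j => i <> j /\ (j = ordS i \/ i = ordS j)
  | None, None => False
  | _, _ => True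
  end.

Program Definition wheel (n : nat) : graph (option 'I_n) := {|
  adj := @wheel_adj n
|}.
Next Obligation.
by move=> n [i|] [j|] //= [/nesym ij [e|e]]; split=> //; [right | left].
Qed.
Next Obligation. by move=> n [i|] //= []. Qed.

Definition has_induced (S T : Type) (W : graph S) (G : graph T) : Prop :=
  exists2 f : S -> T, injective f & forall x y, W x y <-> G (f x) (f y).

Definition wheel_free (T : Type) (G : graph T) : Prop :=
  forall n, 4 <= n -> ~ has_induced (wheel n) G.

Section Automorphisms.
Variables (T : Type) (G : graph T).

Record aut := Aut {
  aut_fun :> T -> T;
  aut_bij : bijective aut_fun;
  aut_adj : forall x y, G (aut_fun x) (aut_fun y) <-> G x y
}.

Program Definition aut_id : aut := {| aut_fun := id |}.
Next Obligation. by exists id. Qed.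
Next Obligation. by []. Qed.

Program Definition aut_comp (g h : aut) : aut := {| aut_fun := g \o h |}.
Next Obligation. by move=> g h; apply: bij_comp; exact: aut_bij. Qed.
Next Obligation. by move=> g h x y /=; rewrite !aut_adj. Qed.

Program Definition image_subgraph (g : aut) (S : subgraph G) : subgraph G := {|
  sverts := g @` sverts S;
  sedge := fun x y => exists a b, [/\ sedge S a b, g a = x & g b = y]
|}.
Next Obligation. by move=> g S x y [a [b [Eab ? ?]]]; exists b, a; split=> //; exact: sedge_sym. Qed.
Next Obligation. by move=> g S x y [a [b [Eab ? ?]]]; exists a => //; exact: sedge_vert Eab. Qed.
Next Obligation.
by move=> g S x y [a [b [Eab <- <-]]]; apply/aut_adj; exact: sedge_adj Eab.
Qed.

End Automorphisms.

Section RegionRepresentations.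
Variables (T U : Type) (G : graph T) (H : graph U).
Implicit Type R : T -> subgraph H.

Definition region_representation R : Prop :=
  (forall v, is_region (R v)) /\
  (forall u v, u <> v -> (G u v <-> sverts (R u) `&` sverts (R v) !=set0)).

Definition acyclic_representation (r : nat) R : Prop :=
  forall X : set T, X #<= `I_r -> acyclic (union_subgraph X R).

Definition is_action (act : aut G -> aut H) : Prop :=
  (forall x, act (aut_id G) x = x) /\
  (forall g h x, act (aut_comp g h) x = act g (act h x)).

Definition canonical_representation R : Prop :=
  exists2 act : aut G -> aut H, is_action act &
    forall g v, image_subgraph (act g) (R v) = R (g v).

End RegionRepresentations.

Section CliqueGraphs.
Variables (T : Type) (G : graph T).

Definition clique (X : set T) : Prop :=
  forall x y, X x -> X y -> x <> y -> G x y.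

Definition maximal_clique (X : set T) : Prop :=
  clique X /\ forall Y, clique Y -> X `<=` Y -> Y = X.

Definition maxclique : Type := {X : set T | maximal_clique X}.

Definition maxcliques_at (v : T) : set maxclique := [set X | sval X v].

Program Definition clique_intersection_graph : graph maxclique := {|
  adj := fun X Y => X <> Y /\ sval X `&` sval Y !=set0
|}.
Next Obligation. by move=> X Y [XY]; rewrite setIC; split=> //; apply/nesym. Qed.
Next Obligation. by move=> X []. Qed.

(* The inclusion of adjacency relations says that [H], whose vertex set is all
   of [maxclique], is a spanning subgraph of [clique_intersection_graph]. *)
Definition is_clique_graph (H : graph maxclique) : Prop :=
  (forall X Y, H X Y -> clique_intersection_graph X Y) /\
  (forall v, connected (induced H (maxcliques_at v))).

Definition clique_graph_regions (H : graph maxclique) (v : T) : subgraph H :=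
  induced H (maxcliques_at v).

Definition has_acyclic_clique_graph (r : nat) : Prop :=
  exists2 H : graph maxclique, is_clique_graph H &
    acyclic_representation r (clique_graph_regions H).

Definition has_acyclic_canonical_representation (r : nat) : Prop :=
  exists (U : Type) (H : graph U) (R : T -> subgraph H),
    [/\ region_representation G R, acyclic_representation r R &
        canonical_representation G R].

Definition has_acyclic_representation (r : nat) : Prop :=
  exists (U : Type) (H : graph U) (R : T -> subgraph H),
    region_representation G R /\ acyclic_representation r R.

End CliqueGraphs.

(* Main.v *)
Require Import Defs.
From mathcomp Require Import all_boot.
From mathcomp Require Import zify.
From mathcomp Require Import finmap boolp classical_sets cardinality.

(** Why the theorem holds.

    From a representation to wheel-freeness ([representation_wheel_free]).  In
    a 3-acyclic representation the union of any three regions is a forest, so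
    inside the tree of the hub of a wheel the regions of the rim vertices cut
    out subtrees ([forest_overlap_reach]), and consecutive ones meet there
    ([helly3]).  An edge of the tree that separates the subtrees of the rim
    vertices 0 and 2 must lie in the subtree of 1, and also in the subtree of
    one of the vertices 3, 4, ... on the other way round; but that vertex is
    not adjacent to 1.

    From local chordality to a representation.  Suppose that the nodes of a
    graph [H] are labelled by cliques of [G] and that the region of [v] is
    induced on the nodes whose label contains [v].  For a nonempty clique [S]
    let [above S] be the set of nodes whose label contains [S].  Every such
    label other than [S] meets exactly one component of the link of [S], its
    set of common neighbours; so [above S] splits into pieces.  If, for every
    [S], the edges of [H] whose two labels meet exactly in [S] form a star on
    these pieces ([star_at]), then each [above S] is a tree ([above_tree]).
    This is an induction from large cliques to small ones.  Within a piece one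
    glues the trees [above (x |` S)], where [x] runs over the link.  The link
    is finite and chordal, so it can be taken apart by deleting simplicial
    vertices, and then each gluing is along a connected overlap
    ([union_forest]).  Three vertices always induce a chordal graph, so the
    same gluing, with [S] empty, shows that three regions have an acyclic union
    ([label_acyclic_representation]).

    Two graphs satisfy the star condition.  For the clique graph the nodes are
    the maximal cliques, and for each [S] one chooses a maximal clique into
    every component of its link and joins the one chosen for a fixed base
    component to all the others ([spoke_star]).  For the canonical
    representation no choice is permitted.  The nodes are then all nonempty
    cliques, and [S] is joined to its union with [center A] for each component
    [A] of its link, where the central clique of a connected finite chordal
    graph is what remains before deleting all simplicial vertices, again and
    again, leaves nothing ([central_star]).  Automorphisms of [G] preserve this
    construction.

    Forests are handled through cuts: every edge is the only edge leaving some
    vertex set.  Unlike cycles, cuts of two graphs can be glued. *)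

Set Implicit Arguments.
Unset Strict Implicit.
Unset Printing Implicit Defensive.

Local Open Scope classical_set_scope.
Local Open Scope card_scope.

(** * Induction on finite sets *)

Lemma finite_set_ltn_ind (T : Type) (P : set T -> Prop) :
  (forall A, finite_set A -> (forall B, B `<=` A -> B <> A -> P B) -> P A) ->
  forall A, finite_set A -> P A.
Proof.
move=> step A finA; have [n] := ubnP #|` @fset_set {classic T} A|.
elim: n A finA => // n IHn A finA ltAn.
apply: step => // B sBA neBA; apply: IHn.
  exact: sub_finite_set finA.
have finB : finite_set B by exact: sub_finite_set finA.
rewrite -ltnS; apply: leq_trans ltAn.
apply: fproper_ltn_card; rewrite fproperEneq.
apply/andP; split; last by rewrite -(@fset_set_sub {classic T}).
by apply/eqP => /(@fset_set_inj {classic T} _ _ finB finA).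
Qed.

(** * Walks *)

Section Reach.
Variable T : Type.
Implicit Types (E F : T -> T -> Prop) (P : set T).

Definition reach E x y := exists n, walk E n x y.

Lemma reach_refl E x : reach E x x.
Proof. by exists 0. Qed.

Lemma reach_step E x y : E x y -> reach E x y.
Proof. by move=> Exy; exists 1; exists y. Qed.

Lemma reach_trans E x y z : reach E x y -> reach E y z -> reach E x z.
Proof.
move=> [n wxy] [m wyz]; exists (n + m).
elim: n x wxy => [|n IHn] x /=; first by move->.
by case=> w Exw wwy; exists w => //; exact: IHn.
Qed.

Lemma reach_sym E x y :
  (forall x y, E x y -> E y x) -> reach E x y -> reach E y x.
Proof.
move=> symE [n]; elim: n x => [|n IHn] x /=; first by move->; exact: reach_refl.
case=> w Exw /IHn ryw; apply: reach_trans ryw _.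
exact/reach_step/symE.
Qed.

Lemma sub_reach E F x y :
  (forall x y, E x y -> F x y) -> reach E x y -> reach F x y.
Proof.
move=> sEF [n]; elim: n x => [|n IHn] x /=; first by move->; exact: reach_refl.
by case=> w Exw /IHn; apply: reach_trans; exact/reach_step/sEF.
Qed.

Lemma reach_invariant E P x y :
  (forall a b, E a b -> P a -> P b) -> reach E x y -> P x -> P y.
Proof.
move=> invP [n]; elim: n x => [|n IHn] x /=; first by move->.
by case=> w Exw wwy Px; apply: IHn wwy _; exact: invP Px.
Qed.

Lemma reach_crossing E P x y :
  reach E x y -> P x -> ~ P y -> exists u v, [/\ E u v, P u & ~ P v].
Proof.
move=> rxy Px nPy; apply: contrapT => noX; apply: nPy.
apply: reach_invariant rxy Px => a b Eab Pa; apply: contrapT => nPb.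
by apply: noX; exists a, b.
Qed.

(** The rest [b ... y] of the walk no longer uses [P], so a cut defined by the
    edge [ab] keeps [b] and [y] on the same side; its length [m] serves
    inductions on walks. *)
Lemma walk_last_exit E P n x y : walk E n x y -> P x -> ~ P y ->
  exists a b m, [/\ E a b, P a, ~ P b, m < n &
    walk (fun u v => [/\ E u v, ~ P u & ~ P v]) m b y].
Proof.
pose outside u v := [/\ E u v, ~ P u & ~ P v].
(* Without [P x] the walk may lie outside [P] altogether. *)
suff main : walk E n x y -> ~ P y -> (~ P x /\ walk outside n x y) \/
    exists a b m, [/\ E a b, P a, ~ P b, m < n & walk outside m b y].
  by move=> wxy Px nPy; case: (main wxy nPy) => [[]|].
elim: n x => [|n IHn] x /=; first by move=> -> ?; left.
case=> w Exw wwy nPy; case: (IHn _ wwy nPy) => [[nPw outw]|].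
  have [Px|nPx] := pselect (P x); first by right; exists x, w, n.
  by left; split=> //; exists w.
case=> a [b [m [Eab Pa nPb ltmn wby]]]; right.
by exists a, b, m; split=> //; exact: ltnW.
Qed.

(** The walk is chosen of minimal length, so that a repeated vertex or a
    chord would give a shorter one. *)
Lemma shortest_walk E x y : reach E x y -> exists k (p : nat -> T),
  [/\ p 0 = x, p k = y, forall i, i < k -> E (p i) (p i.+1),
      forall i j, i < j -> j <= k -> p i <> p j &
      forall i j, i.+1 < j -> j <= k -> ~ E (p i) (p j)].
Proof.
move=> rxy; have exw : exists n, `[< walk E n x y >] by case: rxy => n ?; exists n; apply/asboolP.
case: (ex_minnP exw) => k /asboolP wk mink.
have {}mink m : walk E m x y -> k <= m by move=> wm; exact/mink/asboolP.
have [p [p0 pk pE]] : exists p : nat -> T,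
    [/\ p 0 = x, p k = y & forall i, i < k -> E (p i) (p i.+1)].
  elim: k x wk {rxy exw mink} => [|k IHk] x /=; first by move=> <-; exists (fun=> x).
  case=> z Exz /IHk [p [p0 pk pE]]; exists (fun i => if i is j.+1 then p j else x).
  by split=> // -[|i] //=; rewrite ?p0 // ltnS; exact: pE.
have wsub i j : i <= j -> j <= k -> walk E (j - i) (p i) (p j).
  move=> /subnKC <-; rewrite addKn; move: (j - i) => d.
  elim: d i => [|d IHd] i /=; first by rewrite addn0.
  move=> ltk; exists (p i.+1); first by apply: pE; lia.
  by rewrite addnS -addSn; apply: IHd; lia.
have wcat a b c m n : walk E m a b -> walk E n b c -> walk E (m + n) a c.
  elim: m a => [|m IHm] a /=; first by move->.
  by case=> z Eaz zb bc; exists z => //; exact: IHm.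
have wpre i : i <= k -> walk E i x (p i).
  by move=> leik; have := wsub 0 i (leq0n i) leik; rewrite subn0 p0.
have wpost i : i <= k -> walk E (k - i) (p i) y by move=> leik; rewrite -pk; exact: wsub.
exists k, p; split=> // i j ltij lejk.
  move=> pij; have leik : i <= k by lia.
  have wi := wpre i leik; rewrite pij in wi.
  by have /mink := wcat _ _ _ _ _ wi (wpost j lejk); lia.
move=> Eij; have leik : i <= k by lia.
have wij : walk E 1 (p i) (p j) by exists (p j).
by have /mink := wcat _ _ _ _ _ (wpre i leik) (wcat _ _ _ _ _ wij (wpost j lejk)); lia.
Qed.

End Reach.

(** * Forests *)

Section Forests.
Variable T : Type.
Implicit Types (E F : T -> T -> Prop) (P : set T).

Definition sym_rel E := forall x y, E x y -> E y x.

Definition cut E x y P :=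
  [/\ P x, ~ P y & forall u v, E u v -> P u -> ~ P v -> u = x /\ v = y].

(** Acyclicity, for symmetric and irreflexive [E]: see [forest_no_cycle] and
    [no_cycle_forest]. *)
Definition forest E := forall x y, E x y -> exists P, cut E x y P.

Lemma sub_forest E F : (forall x y, E x y -> F x y) -> forest F -> forest E.
Proof.
move=> sEF forF x y /sEF/forF[P [Px nPy cutP]]; exists P; split=> // u v /sEF.
exact: cutP.
Qed.

Lemma ordS_val n (i : 'I_n.+1) :
  val (ordS i) = if i == n :> nat then 0 else i.+1.
Proof.
rewrite /=; case: eqP => [->|neq]; first by rewrite modnn.
by rewrite modn_small //; have := ltn_ord i; lia.
Qed.

Lemma cycle_of_path E k (p : nat -> T) :
  2 <= k -> (forall i j, i < j -> j <= k -> p i <> p j) ->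
  (forall i, i < k -> E (p i) (p i.+1)) -> E (p k) (p 0) ->
  is_cycle E (fun i : 'I_k.+1 => p i).
Proof.
move=> k2 injp Ep Ek0; split=> // [i j pij|i].
  have [ltij|ltji|/val_inj//] := ltngtP i j.
    by case: (injp i j ltij (ltn_ord j)).
  by case: (injp j i ltji (ltn_ord i)).
rewrite ordS_val; case: eqP => [->//|neq].
by apply: Ep; have := ltn_ord i; lia.
Qed.

Lemma path_of_cycle E n (c : 'I_n -> T) : is_cycle E c ->
  exists k (p : nat -> T), [/\ n = k.+1, forall i, c i = p i, 2 <= k,
    forall i j, i < j -> j <= k -> p i <> p j &
    (forall i, i < k -> E (p i) (p i.+1)) /\ E (p k) (p 0)].
Proof.
case: n c => [|k] c [] // k2 injc Ec.
exists k, (fun i => c (inord i)); split=> //; first by move=> i; rewrite inord_val.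
  move=> i j ltij lejk /injc/(congr1 val) /=.
  by rewrite !inordK ?ltnS ?(leq_trans (ltnW ltij)) // => eqij; move: ltij; rewrite eqij ltnn.
have Sinord i : i < k -> ordS (inord i : 'I_k.+1) = inord i.+1.
  move=> ltik; apply: val_inj; rewrite ordS_val /= !inordK ?ltnS // ?(ltnW ltik) //.
  by case: eqP => // eqik; move: ltik; rewrite eqik ltnn.
split=> [i ltik|]; first by rewrite -Sinord //; exact: Ec.
have -> : inord 0 = ordS (inord k : 'I_k.+1); last exact: Ec.
by apply: val_inj; rewrite ordS_val /= !inordK // eqxx.
Qed.

(** A cycle leaves the cut of its first edge through that edge and has no other
    edge through which to come back. *)
Lemma forest_no_cycle E : sym_rel E -> forest E ->
  forall n (c : 'I_n -> T), ~ is_cycle E c.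
Proof.
move=> symE forE n c /path_of_cycle[k [p [_ _ k2 injp [Ep Ek0]]]].
have [P [P0 nP1 cutP]] := forE _ _ (Ep 0 (ltnW k2)).
have nP i : i < k -> ~ P (p i.+1).
  elim: i => [//|i IHi] ltik PS; have ltik' : i < k by lia.
  have [/esym eq0 _] := cutP _ _ (symE _ _ (Ep i.+1 ltik)) PS (IHi ltik').
  by case: (injp _ _ _ _ eq0).
have nPk : ~ P (p k) by case: k k2 nP {injp Ep Ek0} => // k _; apply.
have [_ /esym eq1] := cutP _ _ (symE _ _ Ek0) P0 nPk.
by case: (injp _ _ _ _ eq1).
Qed.

(** The vertices reachable from [x] without the edge [xy] form its cut: if [y]
    were among them, a shortest walk to it would close up to a cycle. *)
Lemma no_cycle_forest E : sym_rel E -> (forall x, ~ E x x) ->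
  (forall n (c : 'I_n -> T), ~ is_cycle E c) -> forest E.
Proof.
move=> symE irrE noC x y Exy.
pose E' u v := E u v /\ ~ (u = x /\ v = y).
exists [set u | reach E' x u]; split=> /=; first exact: reach_refl.
  move=> rxy; have [k] := shortest_walk rxy; case=> p [p0 pk pE injp _].
  have k2 : 2 <= k.
    case: k pk pE {injp} => [|[|k]] //; rewrite ?p0 => pk pE.
      by case: (irrE x); rewrite {2}pk.
    by case: (pE 0 isT) => _ []; rewrite p0 pk.
  apply: (noC k.+1 (fun i => p i)); apply: cycle_of_path => //.
    by move=> i /pE[].
  by rewrite p0 pk; exact: symE.
move=> u v Euv xu nxv; apply: contrapT => nuv; apply: nxv.
by apply: reach_trans xu _; exact: reach_step.
Qed.

(** If [xy] belongs to both forests, its two cuts agree at [x], and moving along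
    the connected overlap they continue to agree, so their union is a cut. If
    [xy] belongs to [E1] only, its cut in [E1] is constant on the overlap and
    extends to [A2] by this constant. *)
Lemma cut_glue E1 E2 (A1 A2 : set T) : sym_rel E1 -> sym_rel E2 ->
  (forall x y, E1 x y -> A1 x) -> (forall x y, E2 x y -> A2 x) ->
  (forall x y, (A1 `&` A2) x -> (A1 `&` A2) y ->
    reach (fun u v => E1 u v /\ E2 u v) x y) ->
  forest E1 -> forest E2 ->
  forall x y, E1 x y -> exists P, cut (fun x y => E1 x y \/ E2 x y) x y P.
Proof.
move=> symE1 symE2 EA1 EA2 conn for1 for2 x y E1xy.
have [P1 [P1x nP1y cut1]] := for1 _ _ E1xy.
suff [P2 agree cut2] : exists2 P2 : set T,
    (forall u, A1 u -> A2 u -> P1 u <-> P2 u) &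
    (forall u v, E2 u v -> P2 u -> ~ P2 v -> u = x /\ v = y).
  have A1x := EA1 _ _ E1xy; have A1y := EA1 _ _ (symE1 _ _ E1xy).
  exists (fun u => A1 u /\ P1 u \/ A2 u /\ P2 u); split.
  - by left.
  - by case=> -[// A2y P2y]; apply: nP1y; exact/agree.
  - move=> u v [Euv|Euv].
      have A1u := EA1 _ _ Euv; have A1v := EA1 _ _ (symE1 _ _ Euv).
      move=> Pu nPv; apply: cut1 => //; last by move=> P1v; apply: nPv; left.
      by case: Pu => -[// A2u P2u]; exact/agree.
    have A2u := EA2 _ _ Euv; have A2v := EA2 _ _ (symE2 _ _ Euv).
    move=> Pu nPv; apply: cut2 => //; last by move=> P2v; apply: nPv; right.
    by case: Pu => -[// A1u P1u]; exact/agree.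
have [E2xy|nE2xy] := pselect (E2 x y).
  have [P2 [P2x nP2y cut2]] := for2 _ _ E2xy.
  exists P2 => // u A1u A2u.
  have rxu : reach (fun u v => E1 u v /\ E2 u v) x u.
    by apply: conn; split=> //; [exact: EA1 E1xy | exact: EA2 E2xy].
  apply: (reach_invariant (P := fun u => P1 u <-> P2 u)) rxu _; last by split.
  move=> a b [E1ab E2ab] agr; split=> [P1b|P2b]; apply: contrapT => nPb.
    have nP1a : P1 a -> False.
      by move=> P1a; have [? bE] := cut2 _ _ E2ab (iffLR agr P1a) nPb; apply: nP1y; rewrite -bE.
    by have [bE ?] := cut1 _ _ (symE1 _ _ E1ab) P1b nP1a; apply: nPb; rewrite bE.
  have nP2a : P2 a -> False.
    by move=> P2a; have [? bE] := cut1 _ _ E1ab (iffRL agr P2a) nPb; apply: nP2y; rewrite -bE.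
  by have [bE ?] := cut2 _ _ (symE2 _ _ E2ab) P2b nP2a; apply: nPb; rewrite bE.
exists (fun=> exists2 w, (A1 `&` A2) w & P1 w).
  move=> u A1u A2u; split=> [P1u|[w A12w P1w]]; first by exists u.
  apply: reach_invariant (conn _ _ A12w (conj A1u A2u)) P1w => a b [E1ab E2ab] P1a.
  apply: contrapT => nP1b; have [ax bY] := cut1 _ _ E1ab P1a nP1b.
  by apply: nE2xy; rewrite -ax -bY.
by move=> u v _ P2 /(_ P2).
Qed.

Lemma forest_glue E1 E2 (A1 A2 : set T) : sym_rel E1 -> sym_rel E2 ->
  (forall x y, E1 x y -> A1 x) -> (forall x y, E2 x y -> A2 x) ->
  (forall x y, (A1 `&` A2) x -> (A1 `&` A2) y ->
    reach (fun u v => E1 u v /\ E2 u v) x y) ->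
  forest E1 -> forest E2 -> forest (fun x y => E1 x y \/ E2 x y).
Proof.
move=> symE1 symE2 EA1 EA2 conn for1 for2 x y [E1xy|E2xy].
  exact: (cut_glue symE1 symE2 EA1 EA2 conn).
have [|P [Px nPy cutP]] := cut_glue symE2 symE1 EA2 EA1 _ for2 for1 E2xy.
  move=> u v [A2u A1u] [A2v A1v].
  by apply: sub_reach (conn u v (conj A1u A2u) (conj A1v A2v)) => ? ? [].
by exists P; split=> // u v /or_comm/cutP.
Qed.

(** Forests joined by a star of edges, one from the central piece [c] to each
    other piece. An edge between two pieces is cut by the outer one of them. An
    edge inside a piece has a cut [Q] of that piece, and a vertex outside goes
    to the side of the vertex [g] through which the piece is entered from
    there ([gate]); [g] is unique ([gateP]). *)
Lemma forest_star (I : Type) E (piece : T -> I) (c : I) : sym_rel E ->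
  (forall i, forest (fun u v => [/\ E u v, piece u = i & piece v = i])) ->
  (forall u v, E u v -> piece u <> piece v -> piece u = c \/ piece v = c) ->
  (forall u v u' v', E u v -> E u' v' -> piece u = c -> piece u' = c ->
     piece v <> c -> piece v = piece v' -> u = u' /\ v = v') ->
  forest E.
Proof.
move=> symE forP star uniqE x y Exy.
have [xy|nxy] := pselect (piece x = piece y); last first.
  have [xc|yc] := star _ _ Exy nxy.
    exists (fun u => piece u <> piece y); split=> //.
    move=> u v Euv nuy /contrapT vy; have nuv : piece u <> piece v by rewrite vy.
    have vc : piece v <> c by rewrite vy -xc; exact/nesym.
    by have [uc|//] := star _ _ Euv nuv; apply: uniqE.
  exists (fun u => piece u = piece x); split=> //; first exact/nesym.
  move=> u v Euv ux nvx; have nuv : piece u <> piece v by rewrite ux; exact/nesym.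
  have uc : piece u <> c by rewrite ux -yc.
  have [//|vc] := star _ _ Euv nuv.
  by have [] := uniqE _ _ _ _ (symE _ _ Euv) (symE _ _ Exy) vc yc uc ux.
set i := piece x in xy; have [Q [Qx nQy cutQ]] := forP i x y (And3 Exy erefl (esym xy)).
pose gate u g := exists h, [/\ E g h, piece g = i, piece h <> i & i = c -> piece h = piece u].
have gateP u v g : E u v -> piece u <> i -> piece v = i -> gate u g -> g = v.
  move=> Euv ui vi [h [Egh gi hi hu]]; have nuv : piece u <> piece v by rewrite vi.
  have [ic|nic] := pselect (i = c).
    have hc : piece h <> c by rewrite -ic.
    by have [] := uniqE _ _ _ _ Egh (symE _ _ Euv) (etrans gi ic) (etrans vi ic) hc (hu ic).
  have uc : piece u = c by have [//|] := star _ _ Euv nuv; rewrite vi.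
  have nhg : piece h <> piece g by rewrite gi.
  have hc : piece h = c by have [//|] := star _ _ (symE _ _ Egh) nhg; rewrite gi.
  have gc : piece g <> c by rewrite gi.
  by have [] := uniqE _ _ _ _ (symE _ _ Egh) Euv hc uc gc (etrans gi (esym vi)).
exists (fun u => piece u = i /\ Q u \/ piece u <> i /\ exists2 g, gate u g & Q g); split.
- by left.
- by case=> -[] // nyi; case: nyi; rewrite -xy.
- move=> u v Euv [[ui Qu]|[ui [g gu Qg]]] nPv.
    have [vi|vi] := pselect (piece v = i).
      by apply: cutQ => // Qv; apply: nPv; left.
    case: nPv; right; split=> //; exists u => //.
    by exists v; split.
  have [vi|vi] := pselect (piece v = i).
    by case: nPv; left; split=> //; rewrite -(gateP _ _ _ Euv ui vi gu).
  case: nPv; right; split=> //; exists g => //.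
  case: gu => h [Egh gi hi hu]; exists h; split=> // ic; rewrite (hu ic).
  apply: contrapT => nuv; case: (star _ _ Euv nuv); rewrite -ic //.
Qed.

End Forests.

(** * Chordal vertex sets and simplicial vertices *)

Section Chordal.
Variables (T : Type) (G : graph T).
Implicit Types (A B C K : set T).

Definition reach_in A := reach (sedge (induced G A)).

Lemma reach_in_sym A x y : reach_in A x y -> reach_in A y x.
Proof.
by move=> rxy; apply: reach_sym rxy => u v [Au Av Guv]; split=> //; exact: adj_sym.
Qed.

Lemma sub_reach_in A B x y : A `<=` B -> reach_in A x y -> reach_in B x y.
Proof.
by move=> sAB rxy; apply: sub_reach rxy => u v [/sAB ? /sAB ?].
Qed.

Lemma reach_in_mem A x y : reach_in A x y -> A x -> A y.
Proof. by move=> rxy; apply: reach_invariant rxy => u v []. Qed.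

Lemma sub_chordal A B :
  B `<=` A -> chordal (induced G A) -> chordal (induced G B).
Proof.
move=> sBA chA n c n4 [n3 injc Ec].
have [|i [j [ij jSi iSj [_ _ Gij]]]] := chA n c n4.
  by split=> // i; have [/sBA ? /sBA ?] := Ec i.
by exists i, j; split=> //; have [? _ _] := Ec i; have [? _ _] := Ec j.
Qed.

(** Two neighbours of [v] joined by a path that misses the rest of the closed
    neighbourhood of [v] are adjacent: else [v] and a shortest such path form
    a chordless cycle. *)
Lemma chordal_bypass A C v x y : chordal (induced G A) ->
  A v -> A x -> A y -> C `<=` A -> ~ C v -> (forall z, C z -> ~ G v z) ->
  G v x -> G v y -> x <> y ->
  reach_in (C `|` [set x; y]) x y -> G x y.
Proof.
move=> chA Av Ax Ay sCA nCv nGC Gvx Gvy nxy rxy; apply: contrapT => nGxy.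
have [k [p [p0 pk Ep injp nshort]]] := shortest_walk rxy.
have k2 : 2 <= k.
  case: k pk Ep {injp nshort} => [|[|k]] //; rewrite ?p0 => pk Ep //.
  by have [_ _] := Ep 0 isT; rewrite p0 pk.
have pCxy i : i <= k -> (C `|` [set x; y]) (p i).
  rewrite leq_eqVlt => /orP[/eqP->|/Ep[]//].
  by right; right.
have pC i : 0 < i -> i < k -> C (p i).
  move=> i0 ik; case: (pCxy i (ltnW ik)) => // -[pix|piy].
    by case: (injp 0 i i0 (ltnW ik)); rewrite p0 pix.
  by case: (injp i k ik (leqnn k)); rewrite pk piy.
have pA i : i <= k -> A (p i).
  by case/pCxy => [/sCA//|[->|->]].
(* The cycle is [p 0, ..., p k] followed by [v]. *)
pose q i := if i == k.+1 then v else p i.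
have qv : q k.+1 = v by rewrite /q eqxx.
have qp i : i <= k -> q i = p i by rewrite /q; case: eqP => // ->; rewrite ltnn.
have npv i : i <= k -> p i <> v.
  case/pCxy => [Ci iv|[->|->] xv]; first by apply: nCv; rewrite -iv.
    by apply: (@adj_irr _ G v); rewrite -{2}xv.
  by apply: (@adj_irr _ G v); rewrite -{2}xv.
have cycq : is_cycle (sedge (induced G A)) (fun i : 'I_k.+2 => q i).
  apply: cycle_of_path => [|i j ij jk|i ik|]; first by lia.
  - move: jk; rewrite leq_eqVlt => /orP[/eqP jk|jk].
      have ik : i <= k by rewrite -ltnS -jk.
      by rewrite jk qv qp //; exact: npv.
    by rewrite !qp ?(leq_trans (ltnW ij)) //; exact: injp.
  - move: ik; rewrite ltnS leq_eqVlt => /orP[/eqP->|ik].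
      by rewrite qv qp // pk; split=> //; exact: adj_sym.
    have [_ _ Gp] := Ep i ik.
    by rewrite !qp ?(ltnW ik) //; split=> //; apply: pA => //; exact: ltnW.
  - by rewrite qv qp // p0.
have vchord j : 0 < j -> j < k -> ~ G (q k.+1) (q j).
  by move=> j0 jk; rewrite qv qp ?(ltnW jk) //; apply/nGC/pC.
have [i [j []]] := chA k.+2 _ k2 cycq.
wlog ltij : i j / i < j => [wl ij jSi iSj [Ai Aj Gij]|].
  have [lt|lt|/val_inj//] := ltngtP i j; first exact: (wl i j).
  by apply: (wl j i) => //; [exact/nesym | split=> //; exact: adj_sym].
move=> _ jSi iSj [_ _ Gij].
have jk := ltn_ord j.
have {}jSi : j <> i.+1 :> nat.
  by move=> ji; apply: jSi; apply: val_inj; rewrite ordS_val; case: eqP => //; lia.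
have {}iSj : ~ (j = k.+1 :> nat /\ i = 0 :> nat).
  by move=> [jE iE]; apply: iSj; apply: val_inj; rewrite ordS_val jE eqxx.
have [jE|jE] := eqVneq (j : nat) k.+1.
  by apply: (vchord i); [lia | lia | rewrite jE in Gij; exact: adj_sym].
apply: (nshort i j); try lia.
move: Gij; rewrite !qp; try lia; split=> //; apply: pCxy; lia.
Qed.

Definition simplicial A x := A x /\ clique G [set y | A y /\ G x y].

(** Dirac's theorem, in a form that passes to subgraphs: let [v] be a vertex that
    is not adjacent to all others, chosen in [K] if [K] has such a vertex, let
    [C] be a component of what is not adjacent to [v], and let [N] be the set
    of neighbours of [C]. Then [N] is a clique by [chordal_bypass], so by
    induction [C `|` N] has a simplicial vertex outside [N], hence in [C]. It
    is simplicial in [A]. It is not adjacent to [v], so it is outside [K] if [v]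
    is in [K], and also if all vertices of [K] are adjacent to all others. *)
Lemma simplicial_outside_clique A : finite_set A -> forall K,
  chordal (induced G A) -> clique G K -> (exists2 a, A a & ~ K a) ->
  exists2 s, simplicial A s & ~ K s.
Proof.
move: A; apply: finite_set_ltn_ind => A finA IHA K chA clK [a Aa nKa].
have [clA|nclA] := pselect (clique G A).
  by exists a => //; split=> // y z [Ay _] [Az _]; exact: clA.
pose nonuniv v := [/\ A v & exists w, [/\ A w, v <> w & ~ G v w]].
have [v [[Av [w [Aw nvw nGvw]]] Kv]] :
    exists v, nonuniv v /\ (K v \/ forall u, K u -> ~ nonuniv u).
  have [[v [nuv Kv]]|noK] := pselect (exists v, nonuniv v /\ K v).
    by exists v; split=> //; left.
  have [v nuv] : exists v, nonuniv v.
    apply: contrapT => univ; apply: nclA => v w Av Aw nvw; apply: contrapT => nGvw.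
    by apply: univ; exists v; split=> //; exists w.
  by exists v; split=> //; right => u Ku nuu; apply: noK; exists u.
pose far := [set u | [/\ A u, v <> u & ~ G v u]].
pose C := [set u | reach_in far w u].
have farw : far w by [].
have Cfar u : C u -> far u by move=> Cu; exact: reach_in_mem Cu farw.
pose N := [set u | [/\ A u, ~ C u & exists2 z, C z & G u z]].
have GvN u : N u -> G v u.
  move=> [Au nCu [z Cz Guz]]; apply: contrapT => nGvu.
  have [Az nvz nGvz] := Cfar z Cz.
  have nvu : v <> u by move=> vu; apply: nGvz; rewrite vu.
  apply: nCu; apply: reach_trans Cz _; apply: reach_step.
  by split=> //; exact: adj_sym.
have clN : clique G N.
  move=> x y Nx Ny nxy; have [Ax nCx [x' Cx' Gxx']] := Nx.
  have [Ay nCy [y' Cy' Gyy']] := Ny.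
  apply: (@chordal_bypass A C v) => //; try exact: GvN.
  - by move=> u /Cfar[].
  - by move=> /Cfar[].
  - by move=> u /Cfar[].
  have CC : reach_in C x' y'.
    have {}Cy' : reach_in far x' y' by apply: reach_trans Cy'; exact: reach_in_sym.
    case: Cy' => n; elim: n x' Cx' {Gxx'} => [|n IHn] u Cu /=.
      by move->; exact: reach_refl.
    case=> z [faru farz Guz] wz.
    have Cz : C z by apply: reach_trans Cu _; exact: reach_step.
    by apply: reach_trans (IHn z Cz wz); exact: reach_step.
  apply: reach_trans (reach_trans _ (sub_reach_in _ CC)) _.
  - by apply: reach_step; split=> //; [right; left | left].
  - by move=> u ?; left.
  - by apply: reach_step; split=> //; [left | right; right | exact: adj_sym].
pose A' := C `|` N.
have sA'A : A' `<=` A by move=> u [/Cfar[]|[]].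
have nA'v : ~ A' v by case=> [/Cfar[]//|/GvN]; exact: adj_irr.
have Cw : C w by exact: reach_refl.
have [||s [A's cls] nNs] := IHA A' sA'A _ N (sub_chordal sA'A chA) clN.
- by move=> A'A; apply: nA'v; rewrite A'A.
- by exists w; [left | case].
have Cs : C s by case: A's.
have [As nvs nGvs] := Cfar s Cs.
exists s.
  split=> // y z [Ay Gsy] [Az Gsz]; apply: cls.
    split=> //; have [Cy|nCy] := pselect (C y); [by left | right; split=> //].
    by exists s => //; exact: adj_sym.
  split=> //; have [Cz|nCz] := pselect (C z); [by left | right; split=> //].
  by exists s => //; exact: adj_sym.
move=> Ks; case: Kv => [Kv|univ]; first by apply/nGvs/clK.
apply: (univ s Ks); split=> //; exists v; split=> //; first exact/nesym.
by move=> Gsv; apply/nGvs/adj_sym.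
Qed.

Lemma simplicial_exists A : finite_set A -> chordal (induced G A) ->
  A !=set0 -> exists s, simplicial A s.
Proof.
move=> finA chA [a Aa].
have [||s simps _] := simplicial_outside_clique finA (K := set0) chA.
- by [].
- by exists a.
by exists s.
Qed.

(** * The central clique *)

Definition peel k A := iter k (fun B => B `\` simplicial B) A.

(** The last nonempty stage of the peeling. *)
Definition center A := [set x | exists k, peel k A x /\ peel k.+1 A = set0].

Lemma peel_sub k A : peel k A `<=` A.
Proof. by elim: k => [//|k IHk] x [/IHk]. Qed.

Lemma peel_shift k A : peel k.+1 A = peel k (A `\` simplicial A).
Proof. by rewrite /peel iterSr. Qed.

Lemma center_sub A : center A `<=` A.
Proof. by move=> x [k [/peel_sub]]. Qed.

Lemma center_nonempty A : finite_set A -> chordal (induced G A) ->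
  A !=set0 -> center A !=set0.
Proof.
move: A; apply: finite_set_ltn_ind => A finA IHA chA A0.
have [s simps] := simplicial_exists finA chA A0.
have sBA : A `\` simplicial A `<=` A by move=> x [].
have [B0|] := pselect (A `\` simplicial A !=set0).
  have [|x [k [pk pSk]]] := IHA _ sBA _ (sub_chordal sBA chA) B0.
    by move=> BA; have [+ _] := simps; rewrite -BA => -[_]; apply.
  by exists x, k.+1; rewrite (peel_shift k) (peel_shift k.+1).
case: A0 => a Aa noB; exists a, 0; split=> //; apply/seteqP; split=> // x Bx.
by case: noB; exists x.
Qed.

(** A walk through a simplicial vertex can be shortened, as its two neighbours
    on the walk are equal or adjacent. *)
Lemma peel_connected k A :
  (forall x y, A x -> A y -> reach_in A x y) ->
  forall x y, peel k A x -> peel k A y -> reach_in (peel k A) x y.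
Proof.
move=> connA; elim: k => [//|k]; rewrite /peel iterS -/(peel k A).
move: (peel k A) => B connB x y [Bx nsx] [By nsy].
have [n] := connB x y Bx By.
have [m] := ubnP n; elim: m n x Bx nsx => // m IHm [|[|n]] x Bx nsx ltnm.
- by move=> /= ->; exact: reach_refl.
- case=> z [_ _ Gxz] /= zy; rewrite zy in Gxz.
  by apply: reach_step.
case=> z [_ Bz Gxz] /= [t [_ Bt Gzt] wty].
have [[_ clz]|nsz] := pselect (simplicial B z); last first.
  apply: reach_trans (IHm n.+1 z Bz nsz _ _); last 2 first.
  - exact: ltnSE.
  - by exists t.
  exact: reach_step.
have [xt|nxt] := pselect (x = t).
  by apply: (IHm n) => //; [exact/ltnW/ltnSE | rewrite xt].
have Gxt : G x t by apply: clz => //; split=> //; exact: adj_sym.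
by apply: (IHm n.+1) => //; exists t.
Qed.

(** On the last nonempty stage every vertex is simplicial, and simpliciality
    carries adjacency along walks. *)
Lemma center_clique A :
  (forall x y, A x -> A y -> reach_in A x y) -> clique G (center A).
Proof.
move=> connA.
have peel0 k j : k <= j -> peel k A = set0 -> peel j A = set0.
  move=> /subnKC <- pk0; move: (j - k) => d.
  elim: d => [|d IHd]; rewrite ?addn0 // addnS.
  by rewrite /peel iterS -/(peel _ _) IHd set0D.
move=> x y [k [pkx pSk]] [j [pjy pSj]].
have jk : j = k.
  case: (ltngtP j k) => // lt.
    by have pk0 := peel0 _ _ lt pSj; rewrite pk0 in pkx.
  by have pj0 := peel0 _ _ lt pSk; rewrite pj0 in pjy.
move: pjy {pSj}; rewrite jk => pky.
have simp z : peel k A z -> simplicial (peel k A) z.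
  move=> pkz; apply: contrapT => nsz; suff : set0 z by [].
  by rewrite -pSk.
suff xyG : x = y \/ G x y by move=> nxy; case: xyG.
have [n] := peel_connected connA pkx pky.
elim: n x pkx => [|n IHn] x pkx /=; first by left.
case=> z [_ pkz Gxz] wzy; case: (IHn z pkz wzy) => [<-|Gzy]; first by right.
have [xy|nxy] := pselect (x = y); first by left.
by right; have [_ clz] := simp z pkz; apply: clz => //; split=> //; exact: adj_sym.
Qed.

End Chordal.

(** * Links of cliques *)

Section Links.
Variables (T : Type) (G : graph T).
Implicit Types (S K : set T).

Definition link S := [set y | forall x, S x -> G x y].

Definition link_component S x := [set y | reach_in G (link S) x y].

Lemma link_notin S x : link S x -> ~ S x.
Proof. by move=> Lx /Lx; exact: adj_irr. Qed.

Lemma sub_link S S' : S `<=` S' -> link S' `<=` link S.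
Proof. by move=> sSS' y Ly x /sSS'; exact: Ly. Qed.

Lemma clique_link K S x : clique G K -> S `<=` K -> K x -> ~ S x -> link S x.
Proof.
move=> clK sSK Kx nSx y Sy; apply: clK => //; first exact: sSK.
by move=> yx; apply: nSx; rewrite -yx.
Qed.

Lemma clique_reach_link K S x y : clique G K -> S `<=` K ->
  K x -> ~ S x -> K y -> ~ S y -> reach_in G (link S) x y.
Proof.
move=> clK sSK Kx nSx Ky nSy.
have [->|nxy] := pselect (x = y); first exact: reach_refl.
by apply: reach_step; split; [exact: clique_link Kx _ | exact: clique_link Ky _ | exact: clK].
Qed.

Lemma cliqueU1 S x : clique G S -> link S x -> clique G (x |` S).
Proof.
move=> clS Lx y z [->|Sy] [->|Sz] nyz //.
- by apply: adj_sym; exact: Lx.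
- exact: Lx.
- exact: clS.
Qed.

Lemma link_component_eq S x y :
  reach_in G (link S) x y -> link_component S x = link_component S y.
Proof.
move=> rxy; apply/seteqP; split=> z; apply: reach_trans => //.
exact: reach_in_sym.
Qed.

Lemma finite_link S : locally_finite G -> S !=set0 -> finite_set (link S).
Proof.
by move=> lf [s Ss]; apply: sub_finite_set (lf s) => y /(_ _ Ss).
Qed.

End Links.

(** * Graphs on nodes labelled by cliques *)

Section Labelled.
Variables (T U : Type) (G : graph T) (H : graph U) (l : U -> set T).
Implicit Types (S B : set T) (u w : U).

Definition above S := [set u | S `<=` l u].

(** The component of [link S] that [l u] meets, empty if [l u = S]. *)
Definition piece S u :=
  [set y | exists x, [/\ l u x, ~ S x & reach_in G (link G S) x y]].

(** The star, with centre [c], that the edges meeting exactly in [S] draw on the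
    pieces of [above S]. No other edge joins two pieces, because a common vertex
    of two labels outside [S] puts both into the same piece. The last clause
    makes a tree of the one piece that no larger clique accounts for. *)
Definition star_at S := exists c : set T, [/\
  forall u w, H u w -> l u `&` l w = S -> piece S u <> piece S w /\
    (piece S u = c \/ piece S w = c),
  forall u, above S u -> piece S u <> c -> exists u' w,
    [/\ H u' w, above S u', above S w, piece S u' = piece S u & piece S w = c],
  forall u w u' w', above S u -> above S w -> above S u' -> above S w' ->
    H u w -> H u' w' -> piece S u = c -> piece S u' = c ->
    piece S w <> c -> piece S w = piece S w' -> u = u' /\ w = w' &
  forall u w, l u = S -> l w = S -> u = w].

Hypothesis l_clique : forall u, clique G (l u).
Hypothesis l_cover : forall S, clique G S -> S !=set0 -> above S !=set0.

Lemma aboveU1 S x u : above (x |` S) u <-> l u x /\ above S u.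
Proof.
split=> [ab|[lux ab] y [->//|/ab//]].
by split; [apply: ab; left | move=> y Sy; apply: ab; right].
Qed.

Lemma piece_component S u x :
  above S u -> l u x -> ~ S x -> piece S u = link_component G S x.
Proof.
move=> abu lux nSx; apply/seteqP; split=> [y [z [luz nSz]]|y rxy]; last by exists x.
move=> rzy; rewrite /link_component /=.
exact: reach_trans (clique_reach_link (@l_clique u) abu lux nSx luz nSz) rzy.
Qed.

Lemma piece_neq_labelI S u w :
  above S u -> above S w -> piece S u <> piece S w -> l u `&` l w = S.
Proof.
move=> abu abw npuw; apply/seteqP; split=> x; last first.
  by move=> Sx; split; [exact: abu | exact: abw].
move=> [lux lwx]; apply: contrapT => nSx; apply: npuw.
by rewrite (piece_component abu lux nSx) (piece_component abw lwx nSx).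
Qed.

Lemma piece_mem S u x : l u x -> ~ S x -> piece S u x.
Proof. by move=> lux nSx; exists x; split=> //; exact: reach_refl. Qed.

Lemma piece_eq0 S u : above S u -> piece S u = set0 -> l u = S.
Proof.
move=> abu p0; apply/seteqP; split=> // x lux; apply: contrapT => nSx.
by have := piece_mem lux nSx; rewrite p0.
Qed.

(** Along an edge [x z] of the link one passes from [above (x |` S)] to
    [above (z |` S)] through a node above both. *)
Lemma link_path_connected S x y u w :
  (forall z, link G S z -> connected (induced H (above (z |` S)))) ->
  clique G S -> link G S x -> reach_in G (link G S) x y ->
  above (x |` S) u -> above (y |` S) w -> reach_in H (above S) u w.
Proof.
move=> conn clS Lx [n]; elim: n x Lx u => [|n IHn] x Lx u /=.
  move=> <- abu abw; apply: sub_reach_in (conn x Lx u w abu abw).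
  by move=> v /aboveU1[].
case=> z [_ Lz Gxz] wzy abu abw.
have Lxz : link G (x |` S) z by move=> t [->|/Lz].
have [t abt] : above (z |` (x |` S)) !=set0.
  by apply: l_cover; [exact/cliqueU1/Lxz/cliqueU1 | exists z; left].
have [ltz /[dup] abxt /aboveU1[ltx abt']] := (iffLR (aboveU1 _ _ _) abt).
apply: (@reach_trans _ _ _ t).
  apply: sub_reach_in (conn x Lx u t abu abxt).
  by move=> v /aboveU1[].
by apply: (IHn z) => //; apply/aboveU1.
Qed.

(** Induction on [B]: for a simplicial vertex [x] of [B], the part above
    [x |` S] meets the rest in the union of the parts above [y |` (x |` S)],
    for the neighbours [y] of [x] in [B]. These are connected, and any two of
    them meet, because the neighbours of [x] form a clique. *)
Lemma union_forest S B : clique G S -> finite_set B -> B `<=` link G S ->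
  chordal (induced G B) ->
  (forall x, B x -> forest (sedge (induced H (above (x |` S))))) ->
  (forall x y, B x -> B y -> G x y ->
     connected (induced H (above (y |` (x |` S))))) ->
  forest (fun u w => H u w /\
    exists x, [/\ B x, above (x |` S) u & above (x |` S) w]).
Proof.
move=> clS; move: B; apply: finite_set_ltn_ind => B finB IHB sBL chB forB conB.
have [B0|noB] := pselect (B !=set0); last first.
  by move=> u w [_ [x [Bx _ _]]]; case: noB; exists x.
have [x [Bx clx]] := simplicial_exists finB chB B0.
have sB'B : B `\ x `<=` B by move=> y [].
pose E1 u w := H u w /\ exists y, [/\ (B `\ x) y, above (y |` S) u & above (y |` S) w].
pose E2 := sedge (induced H (above (x |` S))).
apply: (@sub_forest _ _ (fun u w => E1 u w \/ E2 u w)).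
  move=> u w [Huw [y [By abu abw]]]; have [yx|nyx] := pselect (y = x).
    by right; rewrite yx in abu abw.
  by left; split=> //; exists y.
apply: (@forest_glue _ _ _ [set u | exists2 y, (B `\ x) y & above (y |` S) u]
  (above (x |` S))) => //.
- by move=> u w [Huw [y [By abu abw]]]; split; [exact: adj_sym | exists y].
- by move=> u w [abu abw Huw]; split=> //; exact: adj_sym.
- by move=> u w [_ [y [By abu _]]]; exists y.
- by move=> u w [].
- have Gx y u : B y -> y <> x -> above (y |` S) u -> above (x |` S) u -> G x y.
    move=> By nyx /aboveU1[luy _] /aboveU1[lux _]; apply: (@l_clique u) => //.
    exact/nesym.
  have conn2 y u w : B y -> G x y -> above (y |` (x |` S)) u ->
      above (y |` (x |` S)) w -> reach (fun u v => E1 u v /\ E2 u v) u w.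
    move=> By Gxy abu abw; apply: sub_reach (conB x y Bx By Gxy u w abu abw).
    move=> a b [/aboveU1[lay aba] /aboveU1[lby abb] Hab].
    have [[lax aba'] [lbx abb']] := (iffLR (aboveU1 _ _ _) aba, iffLR (aboveU1 _ _ _) abb).
    split=> //; split=> //; exists y; split; try exact/aboveU1.
    by split=> // yx; apply: (@adj_irr _ G x); rewrite -{2}yx.
  move=> u w [[y [By nyx] aby] abu] [[z [Bz nzx] abz] abw].
  have [Gxy Gxz] := (Gx y u By nyx aby abu, Gx z w Bz nzx abz abw).
  have [luy _] := iffLR (aboveU1 _ _ _) aby; have [lwz _] := iffLR (aboveU1 _ _ _) abz.
  have abxy : above (y |` (x |` S)) u by exact/aboveU1.
  have abxz : above (z |` (x |` S)) w by exact/aboveU1.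
  have [yz|nyz] := pselect (y = z); first by apply: (conn2 y) => //; rewrite yz.
  have Gyz : G y z by apply: clx.
  have [Lx Ly Lz] : [/\ link G S x, link G (x |` S) y & link G (y |` (x |` S)) z].
    split; first exact: sBL.
      by move=> t [->//|]; exact: sBL.
    by move=> t [->//|[->//|]]; exact: sBL.
  have [t abt] : above (z |` (y |` (x |` S))) !=set0.
    by apply: l_cover; [exact/cliqueU1/Lz/cliqueU1/Ly/cliqueU1 | exists z; left].
  have [ltz abt'] := iffLR (aboveU1 _ _ _) abt.
  have [lty abt''] := iffLR (aboveU1 _ _ _) abt'.
  by apply: (@reach_trans _ _ _ t); [apply: (conn2 y) | apply: (conn2 z) => //; exact/aboveU1].
- apply: IHB => //.
  + move=> BB; have [_ nxx] : (B `\ x) x by rewrite BB.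
    exact: nxx.
  + by move=> y /sB'B/sBL.
  + exact: sub_chordal chB.
  + by move=> y /sB'B/forB.
  + by move=> y z /sB'B By /sB'B Bz; exact: conB.
- exact: forB.
Qed.

Hypothesis link_finite : forall S, S !=set0 -> finite_set (link G S).
Hypothesis link_chordal : forall S, S !=set0 -> chordal (induced G (link G S)).
Hypothesis star : forall S, clique G S -> S !=set0 -> star_at S.

(** Induction on the link of [S], which shrinks when [S] grows. The pieces of
    [above S] are trees by [link_path_connected] and [union_forest], and the
    star makes one tree of them. *)
Lemma above_tree S : clique G S -> S !=set0 ->
  connected (induced H (above S)) /\ forest (sedge (induced H (above S))).
Proof.
move=> clS S0; have [L LE] : exists L, L = link G S by exists (link G S).
have finL : finite_set L by rewrite LE; exact: link_finite.
move: L finL S clS S0 LE; apply: finite_set_ltn_ind => L finL IH S clS S0 LE.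
have {}IH S' : clique G S' -> S `<=` S' -> (exists2 x, S' x & link G S x) ->
    connected (induced H (above S')) /\ forest (sedge (induced H (above S'))).
  move=> clS' sSS' [x S'x Lx]; apply: (IH (link G S')) => //.
  - by rewrite LE; exact: sub_link.
  - by rewrite LE => LL; rewrite -LL in Lx; exact: link_notin Lx S'x.
  - by exists x.
have [c [starA starB starC starD]] := star clS S0.
have IH1 x : link G S x -> connected (induced H (above (x |` S))) /\
    forest (sedge (induced H (above (x |` S)))).
  move=> Lx; apply: IH; first exact: cliqueU1.
    by move=> y Sy; right.
  by exists x => //; left.
split.
  have same_piece u w : above S u -> above S w -> piece S u = piece S w ->
      reach_in H (above S) u w.
    move=> abu abw puw; have [[x pux]|p0] := pselect (piece S u !=set0).
      have [y [luy nSy ryx]] := pux; move: pux; rewrite puw => -[z [lwz nSz rzx]].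
      apply: (@link_path_connected S y z) => //; try exact/aboveU1.
      - by move=> v /IH1[].
      - exact: clique_link (@l_clique u) abu _ _.
      - by apply: reach_trans ryx _; exact: reach_in_sym.
    have pu0 : piece S u = set0 by apply/seteqP; split=> // x pux; case: p0; exists x.
    have lw := piece_eq0 abw (etrans (esym puw) pu0).
    rewrite (starD u w (piece_eq0 abu pu0) lw).
    exact: reach_refl.
  have to_center u : above S u -> exists2 v, above S v /\ piece S v = c & reach_in H (above S) u v.
    move=> abu; have [puc|npuc] := pselect (piece S u = c).
      by exists u => //; exact: reach_refl.
    have [u' [w [Huw abu' abw pu' pw]]] := starB u abu npuc.
    exists w => //; apply: reach_trans (same_piece _ _ abu abu' (esym pu')) _.
    exact: reach_step.
  move=> u w abu abw; have [v [abv pv] ruv] := to_center u abu.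
  have [t [abt pt] rwt] := to_center w abw.
  apply: reach_trans ruv (reach_trans _ (reach_in_sym rwt)).
  by apply: same_piece => //; rewrite pv.
apply: (@forest_star _ _ _ (piece S) c).
- by move=> u w [abu abw Huw]; split=> //; exact: adj_sym.
- move=> i; apply: (@sub_forest _ _ (fun u w => H u w /\
    exists x, [/\ link G S x, above (x |` S) u & above (x |` S) w])).
    move=> u w [[abu abw Huw] pu pw]; split=> //.
    have [[x [[lux lwx] nSx]]|nox] := pselect (exists x, (l u `&` l w) x /\ ~ S x).
      exists x; split; try exact/aboveU1.
      exact: clique_link (@l_clique u) abu _ _.
    have lS : l u `&` l w = S.
      apply/seteqP; split=> x; last by move=> Sx; split; [exact: abu | exact: abw].
      by move=> lx; apply: contrapT => nSx; apply: nox; exists x.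
    by have [] := starA u w Huw lS; rewrite pu pw.
  apply: union_forest => //.
  + exact: link_finite.
  + exact: link_chordal.
  + by move=> x /IH1[].
  + move=> x y Lx Ly Gxy; have [//|||//] := IH (y |` (x |` S)).
    * apply: cliqueU1; first exact: cliqueU1.
      by move=> t [->//|/Ly].
    * by move=> z Sz; right; right.
    * by exists y => //; left.
- move=> u w [abu abw Huw] npuw.
  by have [] := starA u w Huw (piece_neq_labelI abu abw npuw).
- by move=> u w u' w' [abu abw Huw] [abu' abw' Huw']; exact: starC.
Qed.

End Labelled.

(** * Representations from labelled graphs *)

Lemma chordal_card3 (T : Type) (G : graph T) (X : set T) :
  X #<= `I_3 -> chordal (induced G X).
Proof.
move=> X3 n c n4 cyc; have [k [p [nE cp k2 injp _]]] := path_of_cycle cyc.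
have pX i : i <= k -> X (p i).
  move=> lik; have lin : i < n by rewrite nE.
  have [_ _ Ec] := cyc; have [+ _ _] := Ec (Ordinal lin).
  by rewrite cp.
have pI : [set p i | i in `I_k.+1] #= `I_k.+1.
  apply: inj_card_eq => i j; rewrite !inE /= => ik jk pij.
  by case: (ltngtP i j) => // lt; [case: (injp _ _ lt jk) | case: (injp _ _ lt ik)].
have : `I_k.+1 #<= `I_3.
  have /card_eqPle[_ leI] := pI; apply: card_le_trans (card_le_trans leI _) X3.
  by apply: subset_card_le => _ [i /= lik <-]; exact: pX.
rewrite card_le_II; lia.
Qed.

Section LabelledRepresentation.
Variables (T U : Type) (G : graph T) (H : graph U) (l : U -> set T).
Hypothesis l_clique : forall u, clique G (l u).
Hypothesis l_cover : forall S, clique G S -> S !=set0 -> above l S !=set0.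
Hypothesis link_finite : forall S, S !=set0 -> finite_set (link G S).
Hypothesis link_chordal : forall S, S !=set0 -> chordal (induced G (link G S)).
Hypothesis star : forall S, clique G S -> S !=set0 -> star_at G H l S.

Definition label_regions v : subgraph H := induced H [set u | l u v].

Let tree S := above_tree l_clique l_cover link_finite link_chordal star (S := S).

Lemma clique1 v : clique G [set v].
Proof. by move=> x y -> ->. Qed.

Lemma set1_nonempty (v : T) : [set v] !=set0.
Proof. by exists v. Qed.

Lemma clique2 u v : G u v -> clique G [set u; v].
Proof. by move=> Guv x y [->|->] [->|->] //= _; exact: adj_sym. Qed.

Lemma above1 v : above l [set v] = [set u | l u v].
Proof. by apply/seteqP; split=> u; [apply | move=> luv _ ->]. Qed.

Lemma label_region_connected v : connected (label_regions v).
Proof. by rewrite /label_regions -above1; have [] := tree (@clique1 v) (set1_nonempty v). Qed.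

Lemma label_region_representation : region_representation G label_regions.
Proof.
split=> [v|u v nuv].
  split; last exact: label_region_connected.
  by have := l_cover (@clique1 v) (set1_nonempty v); rewrite above1.
split=> [Guv|[w [lwu lwv]]]; last exact: (@l_clique w).
have [|w abw] := l_cover (clique2 Guv); first by exists u; left.
by exists w; split; apply: abw; [left | right].
Qed.

Lemma label_acyclic_representation : acyclic_representation 3 label_regions.
Proof.
move=> X X3; apply: forest_no_cycle; first by move=> x y Exy; exact: sedge_sym.
have aboveU0 x : above l (x |` set0) = [set u | l u x] by rewrite setU0 above1.
apply: (@sub_forest _ _ (fun u w => H u w /\
    exists x, [/\ X x, above l (x |` set0) u & above l (x |` set0) w])).
  by move=> u w [x Xx [lux lwx Huw]]; split=> //; exists x; rewrite !aboveU0.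
apply: union_forest => //.
- by apply/finite_set_leP; exists 3.
- by move=> x Xx y.
- exact: chordal_card3.
- move=> x _; rewrite setU0.
  by have [] := tree (@clique1 x) (set1_nonempty x).
- move=> x y _ _ Gxy; rewrite setU0.
  by have [||] := @tree (y |` [set x]); [apply/clique2/adj_sym | exists y; left|].
Qed.

End LabelledRepresentation.

(** * Wheels and local chordality *)

Section Wheels.
Variables (T : Type) (G : graph T).

(** The ball of radius [3/2] is the subgraph induced on the closed
    neighbourhood: adjacent vertices whose distances add up to less than 3 are
    both at distance at most 1. *)
Lemma half_ball3_edge v x y : sedge (half_ball G 3 v) x y <->
  [/\ x = v \/ G v x, y = v \/ G v y & G x y].
Proof.
have dist1 u : u = v \/ G v u -> exists2 a, is_dist G v u a & a <= 1.
  case=> [->|Gvu]; first by exists 0.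
  exists 1 => //; split; first by exists u.
  by case=> //= vu; case: (@adj_irr _ G u); rewrite {1}vu in Gvu *.
have nbh u w a b : G u w -> is_dist G v u a -> is_dist G v w b -> a + b < 3 ->
    u = v \/ G v u.
  move=> Guw [wu mina] [ww _] lt3; have a1 : a <= 1.
    case: b ww lt3 => [|b] ww lt3; last by lia.
    by apply: mina; exists u => //=; rewrite ww; exact: adj_sym.
  case: a wu a1 {mina lt3} => [|[|//]] /=; first by left.
  by case=> z Gvz <-; right.
split=> [[Gxy [a [b [dx dy lt3]]]]|[nx ny Gxy]].
  split=> //; first exact: nbh dx dy lt3.
  by rewrite addnC in lt3; apply: nbh dy dx lt3; exact: adj_sym.
split=> //; have [[a da a1] [b db b1]] := (dist1 x nx, dist1 y ny).
by exists a, b; split=> //; lia.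
Qed.

Lemma ordS_neq n (i : 'I_n) : 2 <= n -> ordS i <> i.
Proof.
case: n i => // n i n2 /(congr1 val); rewrite ordS_val.
by have := ltn_ord i; case: eqP => ? ? /=; lia.
Qed.

(** The link of [S] lies in the ball around any vertex of [S]. *)
Lemma link_chordal S :
  locally_chordal 3 G -> S !=set0 -> chordal (induced G (link G S)).
Proof.
move=> lc [s Ss] n c n4 [n3 injc Ec].
have Gsc i : G s (c i) by have [Lc _ _] := Ec i; exact: Lc.
have [|i [j [ij jSi iSj /half_ball3_edge[_ _ Gij]]]] := lc s n c n4.
  split=> // i; apply/half_ball3_edge.
  by have [_ _ Gc] := Ec i; split=> //; right.
exists i, j; split=> //.
by have [Li _ _] := Ec i; have [Lj _ _] := Ec j.
Qed.

Lemma locally_chordal_wheel_free : locally_chordal 3 G -> wheel_free G.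
Proof.
move=> lc n n4 [f injf fE].
have hub i : G (f None) (f (Some i)) by apply/fE.
have n2 : 2 <= n by exact: leq_trans n4.
have cyc : is_cycle (sedge (half_ball G 3 (f None))) (fun i : 'I_n => f (Some i)).
  split=> [|i j /injf[]//|i]; first exact: leq_trans n4.
  apply/half_ball3_edge; split; try by right.
  by apply/fE; split; [exact/nesym/ordS_neq | left].
have [i [j [ij jSi iSj /half_ball3_edge[_ _ /fE[_ [|]]]]]] := lc _ _ _ n4 cyc.
  exact: jSi.
exact: iSj.
Qed.

(** A chordless cycle in the ball around [v] avoids [v], which is adjacent to
    the whole ball, and so is the rim of a wheel with hub [v]. *)
Lemma wheel_free_locally_chordal : wheel_free G -> locally_chordal 3 G.
Proof.
move=> wf v n c n4 [n3 injc Ec]; apply: contrapT => nochord.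
have Ec' i : [/\ c i = v \/ G v (c i), c (ordS i) = v \/ G v (c (ordS i)) &
    G (c i) (c (ordS i))] by exact/half_ball3_edge.
have chord i j : i <> j -> G (c i) (c j) -> j = ordS i \/ i = ordS j.
  move=> ij Gij; apply: contrapT => /not_orP[jSi iSj]; apply: nochord.
  exists i, j; split=> //; apply/half_ball3_edge; split=> //.
    by have [] := Ec' i.
  by have [] := Ec' j.
have cv i : c i <> v.
  move=> civ; pose j := ordS (ordS i).
  have [ij [jSi iSj]] : i <> j /\ j <> ordS i /\ i <> ordS j.
    rewrite /j; case: n c n4 {n3 injc Ec nochord chord Ec'} i civ j => // n c n4 i civ j.
    have ltin := ltn_ord i.
    split; [|split]; move=> /(congr1 val); rewrite !ordS_val;
      by do ?case: eqP => /=; lia.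
  case: (chord i j) => //; rewrite civ; have [+ _ _] := Ec' j.
  by case=> // cjv; case: ij; apply: injc; rewrite civ.
have Gvc i : G v (c i) by have [[/cv//|//] _ _] := Ec' i.
apply: (wf n n4); exists (fun x => if x is Some i then c i else v).
  move=> [i|] [j|] //= => [/injc->//|civ|vcj].
    by case: (cv i).
  by case: (cv j).
move=> [i|] [j|] //=; split=> //.
- move=> [_ [->|->]]; first by have [] := Ec' i.
  by apply: adj_sym; have [] := Ec' j.
- move=> Gij; have ij : i <> j.
    by move=> ij; apply: (@adj_irr _ G (c i)); rewrite {2}ij.
  by split=> //; exact: chord.
- by move=> _; exact: adj_sym.
- by move=> Gvv; exact: adj_irr Gvv.
Qed.

End Wheels.

(** * Subtrees of a tree *)

Section Subtrees.
Variables (U : Type) (H : graph U).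

(** An edge at which a shortest path of [E1] could leave [E2] separates its two
    ends, so that the walk in [E2] has to cross it as well. *)
Lemma forest_overlap_reach (E1 E2 : U -> U -> Prop) x y :
  sym_rel E1 -> sym_rel E2 -> forest (fun u v => E1 u v \/ E2 u v) ->
  reach E1 x y -> reach E2 x y -> reach (fun u v => E1 u v /\ E2 u v) x y.
Proof.
move=> symE1 symE2 for12 [n]; have [m] := ubnP n.
elim: m n x => // m IHm n x ltnm wxy rxy.
have [->|nxy] := pselect (x = y); first exact: reach_refl.
have [a [b [k [+ ax nbx ltkn wby]]]] := walk_last_exit (P := [set x]) wxy erefl (nesym nxy).
rewrite ax => E1xb; have [P [Px nPb cutP]] := for12 _ _ (or_introl E1xb).
have nPy : ~ P y.
  apply: (reach_invariant (P := ~` P)) (ex_intro _ k wby) nPb => u v [E1uv nux nvx] nPu Pv.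
  by have [vx _] := cutP _ _ (or_introl (symE1 _ _ E1uv)) Pv nPu; exact: nvx.
have [u [v [E2uv Pu nPv]]] := reach_crossing rxy Px nPy.
have [ux vb] := cutP _ _ (or_intror E2uv) Pu nPv; rewrite ux vb in E2uv.
apply: (@reach_trans _ _ _ b); first exact: reach_step.
apply: (IHm k); first exact: leq_trans ltkn _.
  by elim: k b wby {nbx ltkn E1xb nPb cutP vb E2uv} => [|k IHk] b //= [z [? _ _] /IHk]; exists z.
by apply: reach_trans rxy; apply: reach_step; exact: symE2.
Qed.

Lemma sedge_vertr (S : subgraph H) u v : sedge S u v -> sverts S v.
Proof. by move=> Suv; apply: sedge_vert (sedge_sym Suv). Qed.

(** The edge at which a path of [S2] from [S1] to [S3] leaves [S1] for good
    separates [S1] from the end of the path, so that [S3] uses this edge. *)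
Lemma helly3 (S1 S2 S3 : subgraph H) :
  connected S1 -> connected S2 -> connected S3 ->
  forest (fun u v => [\/ sedge S1 u v, sedge S2 u v | sedge S3 u v]) ->
  sverts S1 `&` sverts S2 !=set0 -> sverts S2 `&` sverts S3 !=set0 ->
  sverts S1 `&` sverts S3 !=set0 ->
  exists x, [/\ sverts S1 x, sverts S2 x & sverts S3 x].
Proof.
move=> con1 con2 con3 for123 [a [A1a A2a]] [b [A2b A3b]] [c [A1c A3c]].
have [A1b|nA1b] := pselect (sverts S1 b); first by exists b.
have [n wab] := con2 a b A2a A2b.
have [x [y [k [E2xy A1x nA1y _ wyb]]]] := walk_last_exit wab A1a nA1b.
have [P [Px nPy cutP]] := for123 _ _ (Or32 _ _ E2xy).
have nPb : ~ P b.
  apply: (reach_invariant (P := ~` P)) (ex_intro _ k wyb) nPy => u v [E2uv nu nv] nPu Pv.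
  by have [vx _] := cutP _ _ (Or32 _ _ (sedge_sym E2uv)) Pv nPu; apply: nv; rewrite vx.
have Pc : P c.
  apply: reach_invariant (con1 x c A1x A1c) Px => u v E1uv Pu; apply: contrapT => nPv.
  have [_ vy] := cutP _ _ (Or31 _ _ E1uv) Pu nPv.
  by apply: nA1y; rewrite -vy; exact: sedge_vertr E1uv.
have [u [v [E3uv Pu nPv]]] := reach_crossing (con3 c b A3c A3b) Pc nPb.
have [ux _] := cutP _ _ (Or33 _ _ E3uv) Pu nPv.
exists x; split=> //; first exact: sedge_vert E2xy.
by rewrite -ux; exact: sedge_vert E3uv.
Qed.

End Subtrees.

(** * Acyclic representations exclude wheels *)

Section RepresentationWheelFree.
Variables (T U : Type) (G : graph T) (H : graph U) (R : T -> subgraph H).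
Hypothesis repR : region_representation G R.
Hypothesis acyR : acyclic_representation 3 R.

Lemma acyclic3_forest a b c :
  forest (fun u v => [\/ sedge (R a) u v, sedge (R b) u v | sedge (R c) u v]).
Proof.
apply: (@sub_forest _ _ (sedge (union_subgraph [set x | [\/ x = a, x = b | x = c]] R))).
  move=> u v [E|E|E] /=; [exists a | exists b | exists c] => //.
  - exact: Or31.
  - exact: Or32.
  - exact: Or33.
apply: no_cycle_forest.
- by move=> u v; exact: sedge_sym.
- by move=> u Euu; apply: adj_irr (sedge_adj Euu).
- apply: acyR; pose p i := if i is 0 then a else if i is 1 then b else c.
  apply: card_le_trans (card_image_le p `I_3); apply: subset_card_le.
  by move=> x [->|->|->]; [exists 0 | exists 1 | exists 2].
Qed.

Lemma region_connected v : connected (R v).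
Proof. by have [_] := repR.1 v. Qed.

Lemma region_overlap_reach a b x y : (sverts (R a) `&` sverts (R b)) x ->
  (sverts (R a) `&` sverts (R b)) y ->
  reach (fun u v => sedge (R a) u v /\ sedge (R b) u v) x y.
Proof.
move=> [ax bx] [ay b_y]; apply: forest_overlap_reach.
- by move=> u v; exact: sedge_sym.
- by move=> u v; exact: sedge_sym.
- by apply: sub_forest (@acyclic3_forest a b b) => u v [?|?]; [exact: Or31|exact: Or32].
- exact: region_connected.
- exact: region_connected.
Qed.

(** The cut [P] below separates the subtrees of the rim vertices 0 and 2 within
    the region of the hub; the edge [xy] that defines it is the last one on
    which a walk leaves the region of the rim vertex 0. *)
Lemma representation_wheel_free : wheel_free G.
Proof.
case=> [//|k] k4 [f injf fE].
pose h := f None; pose r i := f (Some (inord i : 'I_k.+1)).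
have hr i : G h (r i) by apply/fE.
have eqr i j : i <= k -> j <= k -> r i = r j -> i = j.
  by move=> ik jk /injf[] /(congr1 val); rewrite /= !inordK.
have rE i j : i < j -> j <= k -> G (r i) (r j) <-> j = i.+1 \/ (i = 0 /\ j = k).
  move=> ij jk; have ik : i <= k by exact: leq_trans (ltnW ij) jk.
  have ordE (a b : 'I_k.+1) : (a = b) <-> (a = b :> nat) by split=> [->//|/val_inj].
  rewrite /r -fE /= !ordE !ordS_val /= !inordK ?ltnS //.
  by split=> [[_ []]|]; do ?[case: eqP => ?]; lia.
have disj i j x : i.+1 < j -> j <= k -> ~ (i = 0 /\ j = k) ->
    sverts (R (r i)) x -> ~ sverts (R (r j)) x.
  move=> ij jk nc Six Sjx; have ik : i <= k by lia.
  have nr : r i <> r j by move=> /(eqr _ _ ik jk); lia.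
  have Gij : G (r i) (r j) by apply/(repR.2 _ _ nr); exists x.
  by have [|/nc//] := iffLR (rE i j (ltnW ij) jk) Gij; lia.
have meet3 i j : i <= k -> j <= k -> r i <> r j -> G (r i) (r j) -> exists x,
    [/\ sverts (R h) x, sverts (R (r i)) x & sverts (R (r j)) x].
  have meet u v : G u v -> sverts (R u) `&` sverts (R v) !=set0.
    move=> Guv; apply/repR.2 => // uv; apply: (@adj_irr _ G u).
    by rewrite {2}uv.
  move=> ik jk nr Gij; apply: helly3; try exact: region_connected.
  - exact: acyclic3_forest.
  - exact: meet.
  - exact: meet.
  - exact: meet.
have meetS i : i < k -> exists x,
    [/\ sverts (R h) x, sverts (R (r i)) x & sverts (R (r i.+1)) x].
  move=> ik; apply: meet3 => //; first exact: ltnW.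
    by move=> /(eqr _ _ (ltnW ik) ik); lia.
  by apply/rE => //; left.
have [q01 [hq01 q01_0 q01_1]] := meetS 0 ltac:(lia).
have [q12 [hq12 q12_1 q12_2]] := meetS 1 ltac:(lia).
have [qk0 [hqk0 qk0_0 qk0_k]] : exists x,
    [/\ sverts (R h) x, sverts (R (r 0)) x & sverts (R (r k)) x].
  apply: meet3 => //; first by move=> /(eqr _ _ (leq0n k) (leqnn k)); lia.
  by apply/rE => //; [lia | right].
have n02 : ~ sverts (R (r 0)) q12.
  by move=> q12_0; apply: (disj 0 2 q12) => //; lia.
have [n wq] := region_connected hq01 hq12.
have [x [y [m [hxy x0 ny0 _ wy]]]] := walk_last_exit wq q01_0 n02.
have [P [Px nPy cutP]] := @acyclic3_forest h h h _ _ (Or31 _ _ hxy).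
have nPq12 : ~ P q12.
  apply: (reach_invariant (P := ~` P)) (ex_intro _ m wy) nPy => u v [huv nu nv] nPu Pv.
  have [vx _] := cutP _ _ (Or31 _ _ (sedge_sym huv)) Pv nPu.
  by apply: nv; rewrite vx.
(* A region on both sides of the cut uses the edge [xy]. *)
have crossing i p p' : (sverts (R h) `&` sverts (R (r i))) p ->
    (sverts (R h) `&` sverts (R (r i))) p' -> P p -> ~ P p' ->
    sverts (R (r i)) x /\ sverts (R (r i)) y.
  move=> ip ip' Pp nPp'.
  have [u [v [[huv iuv] Pu nPv]]] := reach_crossing (region_overlap_reach ip ip') Pp nPp'.
  have [<- <-] := cutP _ _ (Or31 _ _ huv) Pu nPv.
  by split; [exact: sedge_vert iuv | exact: sedge_vertr iuv].
have side0 p : sverts (R h) p -> sverts (R (r 0)) p -> P p.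
  move=> hp p0; apply: contrapT => nPp.
  have [_ y0] := crossing 0 x p (conj (sedge_vert hxy) x0) (conj hp p0) Px nPp.
  exact: ny0.
have x1 : sverts (R (r 1)) x.
  by have [] := crossing 1 q01 q12 (conj hq01 q01_1) (conj hq12 q12_1) (side0 _ hq01 q01_0) nPq12.
(* Going round the other way, the regions of 2, 3, ... stay on the far side: the
   first one to cross the cut would meet the region of 0 or of 1 in [x]. *)
have side i : i.+2 <= k -> forall p, sverts (R h) p -> sverts (R (r i.+2)) p -> ~ P p.
  elim: i => [|i IHi] ik p hp pi Pp.
    have [x2 _] := crossing 2 p q12 (conj hp pi) (conj hq12 q12_2) Pp nPq12.
    by apply: (disj 0 2 x) => //; lia.
  have [q [hq qi qSi]] := meetS i.+2 ik.
  have nPq : ~ P q by apply: (IHi _ q) => //; exact: ltnW.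
  have [xi _] := crossing i.+3 p q (conj hp pi) (conj hq qSi) Pp nPq.
  by apply: (disj 1 i.+3 x) => //; lia.
have kE : (k - 2).+2 = k by lia.
by apply: (side (k - 2) _ qk0) => //; rewrite ?kE //; exact: side0.
Qed.

End RepresentationWheelFree.

(** * Construction of an acyclic clique graph *)

Section CliqueGraph.
Variables (T : Type) (G : graph T).
Hypothesis lfG : locally_finite G.
Implicit Types (S A K : set T).

(** Adding vertices of the link one at a time, until it is empty. *)
Lemma maximal_clique_extension S : clique G S -> S !=set0 ->
  exists2 K, maximal_clique G K & S `<=` K.
Proof.
move=> clS S0; have [L LE] : exists L, L = link G S by exists (link G S).
have finL : finite_set L by rewrite LE; exact: finite_link.
move: L finL S clS S0 LE; apply: finite_set_ltn_ind => L finL IH S clS S0 LE.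
have [[x Lx]|noL] := pselect (link G S !=set0); last first.
  exists S => //; split=> // K clK sSK; apply/seteqP; split=> // y Ky.
  by apply: contrapT => nSy; apply: noL; exists y; exact: clique_link Ky nSy.
have sSxS : S `<=` x |` S by move=> y Sy; right.
have [|||||K maxK sxSK] := IH (link G (x |` S)) _ _ (x |` S).
- by rewrite LE; exact: sub_link.
- rewrite LE => LL; rewrite -LL in Lx.
  by apply: link_notin Lx _; left.
- exact: cliqueU1.
- by exists x; left.
- by [].
by exists K => // y Sy; apply/sxSK/sSxS.
Qed.

Definition is_link_component S A := exists2 x, link G S x & A = link_component G S x.

Lemma clique_meets_component K S A x : clique G K -> S `<=` K ->
  is_link_component S A -> K x -> A x -> ~ S x /\ A = link_component G S x.
Proof.
move=> clK sSK [y Ly ->] Kx Ax; split; last exact: link_component_eq.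
exact/link_notin/(reach_in_mem Ax).
Qed.

Definition neighbour_choice (nbr : set T -> set T -> set T) :=
  forall S A, clique G S -> S !=set0 -> is_link_component S A ->
    [/\ maximal_clique G (nbr S A), S `<=` nbr S A & exists2 x, nbr S A x & A x].

Lemma neighbour_choice_exists : exists nbr, neighbour_choice nbr.
Proof.
have : forall SA : set T * set T, exists K : set T, clique G SA.1 -> SA.1 !=set0 ->
    is_link_component SA.1 SA.2 ->
    [/\ maximal_clique G K, SA.1 `<=` K & exists2 x, K x & SA.2 x].
  move=> [S A] /=; have [[clS S0 [x Lx ->]]|no] :=
      pselect [/\ clique G S, S !=set0 & is_link_component S A]; last first.
    by exists set0 => clS S0 SA; case: no.
  have [||K maxK sK] := @maximal_clique_extension (x |` S).
  - exact: cliqueU1.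
  - by exists x; left.
  exists K => _ _ _; split=> //; first by move=> y Sy; apply: sK; right.
  by exists x; [apply: sK; left | exact: reach_refl].
by move=> /choice[nbr nbrP]; exists (fun S A => nbr (S, A)) => S A; exact: (nbrP (S, A)).
Qed.

(** If [S] is a maximal clique its link is empty, and the only piece of
    [above S] is empty: hence the value [set0]. *)
Definition base_choice (base : set T -> set T) := forall S,
  (link G S !=set0 -> is_link_component S (base S)) /\
  (~ (link G S !=set0) -> base S = set0).

Lemma base_choice_exists : exists base, base_choice base.
Proof.
have : forall S, exists A, (link G S !=set0 -> is_link_component S A) /\
    (~ (link G S !=set0) -> A = set0).
  move=> S; have [[x Lx]|no] := pselect (link G S !=set0); last by exists set0.
  exists (link_component G S x); split=> [_|[]]; first by exists x.
  by exists x.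
by move=> /choice[base baseP]; exists base.
Qed.

Variables (nbr : set T -> set T -> set T) (base : set T -> set T).
Hypotheses (nbrP : neighbour_choice nbr) (baseP : base_choice base).

(** An edge of the star of [S], from its centre [X] to the piece [A]. *)
Definition spoke S A (X Y : maxclique G) := [/\ clique G S /\ S !=set0,
  is_link_component S A, A <> base S, sval X = nbr S (base S) & sval Y = nbr S A].

Definition spoke_adj (X Y : maxclique G) :=
  exists S A, spoke S A X Y \/ spoke S A Y X.

Lemma maxclique_clique (X : maxclique G) : clique G (sval X).
Proof. by have [] := svalP X. Qed.

(** The two labels meet exactly in [S], since a further common vertex would put
    both into the same component; so a spoke of [S] is not a spoke of any other
    clique. *)
Lemma spoke_pieces S A X Y : spoke S A X Y -> [/\ sval X `&` sval Y = S,
  piece G (@sval _ _) S X = base S & piece G (@sval _ _) S Y = A].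
Proof.
move=> [[clS S0] compA nAb XE YE].
have compb : is_link_component S (base S).
  by apply: (baseP S).1; have [x Lx _] := compA; exists x.
have [_ sSX [x Xx bx]] := nbrP clS S0 compb.
have [_ sSY [y Yy Ay]] := nbrP clS S0 compA.
rewrite -XE in sSX Xx; rewrite -YE in sSY Yy.
have clX := @maxclique_clique X; have clY := @maxclique_clique Y.
have [nSx bE] := clique_meets_component clX sSX compb Xx bx.
have [nSy AE] := clique_meets_component clY sSY compA Yy Ay.
have pX : piece G (@sval _ _) S X = base S.
  by rewrite bE; apply: piece_component => //; exact: maxclique_clique.
have pY : piece G (@sval _ _) S Y = A.
  by rewrite AE; apply: piece_component => //; exact: maxclique_clique.
split=> //; apply: (@piece_neq_labelI _ _ G) => //; first exact: maxclique_clique.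
by rewrite pX pY; exact/nesym.
Qed.

Lemma spoke_adj_sym X Y : spoke_adj X Y -> spoke_adj Y X.
Proof. by move=> [S [A XY]]; exists S, A; exact/or_comm. Qed.

Lemma spoke_neq S A X Y : spoke S A X Y -> X <> Y.
Proof.
move=> XY eXY; have [_ pX pY] := spoke_pieces XY; have [_ _ nAb _ _] := XY.
by apply: nAb; rewrite -pX -pY eXY.
Qed.

Lemma spoke_adj_irr X : ~ spoke_adj X X.
Proof. by move=> [S [A [/spoke_neq|/spoke_neq]]]. Qed.

Definition spoke_graph : graph (maxclique G) := Graph spoke_adj_sym spoke_adj_irr.

Lemma spoke_star S : clique G S -> S !=set0 -> star_at G spoke_graph (@sval _ _) S.
Proof.
move=> clS S0; exists (base S); split.
- move=> X Y [S' [A [sp|sp]]] XYS; have [S'E pX pY] := spoke_pieces sp;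
    have [_ _ nAb _ _] := sp.
    by rewrite XYS in S'E; subst S'; rewrite pX pY; split; [exact/nesym | left].
  by rewrite setIC XYS in S'E; subst S'; rewrite pX pY; split; [|right].
- move=> X abX npX.
  have [x [Xx nSx]] : exists x, sval X x /\ ~ S x.
    apply: contrapT => no; have XS : sval X = S.
      apply/seteqP; split=> // x Xx; apply: contrapT => nSx.
      by apply: no; exists x.
    have noL : ~ (link G S !=set0).
      move=> [x Lx]; have [_ maxX] := svalP X.
      have Sx : (x |` S) `<=` S.
        rewrite -[X in _ `<=` X]XS -(maxX (x |` S)) //; first exact: cliqueU1.
        by rewrite XS => y Sy; right.
      by apply: link_notin Lx _; apply: Sx; left.
    apply: npX; rewrite ((baseP S).2 noL); apply/seteqP; split=> // y [x [Xx nSx _]].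
    by apply: nSx; rewrite -XS.
  have Lx : link G S x := clique_link (@maxclique_clique X) abX Xx nSx.
  have pX : piece G (@sval _ _) S X = link_component G S x.
    by apply: piece_component => //; exact: maxclique_clique.
  have compA : is_link_component S (piece G (@sval _ _) S X) by rewrite pX; exists x.
  have compb : is_link_component S (base S) by apply: (baseP S).1; exists x.
  have [maxY sSY _] := nbrP clS S0 compA; have [maxZ sSZ _] := nbrP clS S0 compb.
  pose Y : maxclique G := exist _ _ maxY; pose Z : maxclique G := exist _ _ maxZ.
  have sp : spoke S (piece G (@sval _ _) S X) Z Y by split.
  have [_ pZ pY] := spoke_pieces sp.
  by exists Y, Z; split=> //; exists S, (piece G (@sval _ _) S X); right.
- suff edge X Y : above (@sval _ _) S X -> above (@sval _ _) S Y -> spoke_adj X Y ->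
      piece G (@sval _ _) S X = base S -> piece G (@sval _ _) S Y <> base S ->
      sval X = nbr S (base S) /\ sval Y = nbr S (piece G (@sval _ _) S Y).
    move=> X Y X' Y' abX abY abX' abY' XY XY' pX pX' pY pYY'.
    have pY' : piece G (@sval _ _) S Y' <> base S by rewrite -pYY'.
    have [XE YE] := edge X Y abX abY XY pX pY.
    have [XE' YE'] := edge X' Y' abX' abY' XY' pX' pY'.
    split; apply: eq_sig_hprop; rewrite ?XE ?XE' ?YE ?YE' ?pYY' // => ? ? ?;
      exact: Prop_irrelevance.
  move=> abX abY [S' [A sp]] pX pY.
  have SE : sval X `&` sval Y = S.
    apply: (@piece_neq_labelI _ _ G) => //; first exact: maxclique_clique.
    by rewrite pX; exact/nesym.
  case: sp => sp; have [S'E pX' pY'] := spoke_pieces sp; have [_ _ _ XE YE] := sp.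
    by rewrite SE in S'E; subst S'; rewrite pY'.
  by rewrite setIC SE in S'E; subst S'; case: pY.
- move=> X Y XS YS; apply: eq_sig_hprop; last by rewrite XS.
  by move=> ? ? ?; exact: Prop_irrelevance.
Qed.

End CliqueGraph.

Lemma locally_chordal_acyclic_clique_graph (T : Type) (G : graph T) :
  locally_finite G -> locally_chordal 3 G -> has_acyclic_clique_graph G 3.
Proof.
move=> lfG lcG; have [nbr nbrP] := neighbour_choice_exists lfG.
have [base baseP] := base_choice_exists G.
pose H := spoke_graph nbrP baseP; pose l (X : maxclique G) := sval X.
have cover S : clique G S -> S !=set0 -> above l S !=set0.
  move=> clS S0; have [K maxK sSK] := maximal_clique_extension lfG clS S0.
  by exists (exist _ K maxK).
have finlink S : S !=set0 -> finite_set (link G S) by exact: finite_link.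
have chlink S : S !=set0 -> chordal (induced G (link G S)) by exact: link_chordal.
have starH := spoke_star nbrP baseP.
exists H; last first.
  exact: (label_acyclic_representation (@maxclique_clique _ G) cover finlink chlink starH).
split; last first.
  exact: (label_region_connected (@maxclique_clique _ G) cover finlink chlink starH).
move=> X Y XY; split.
  by move=> eXY; apply: (@adj_irr _ H X); rewrite {2}eXY.
case: XY => S [A [sp|sp]]; have [[_ [s Ss]] _ _ _ _] := sp;
  have [SE _ _] := spoke_pieces nbrP baseP sp; exists s; last rewrite setIC; by rewrite SE.
Qed.

Lemma clique_graph_representation (T : Type) (G : graph T) :
  locally_finite G -> has_acyclic_clique_graph G 3 -> has_acyclic_representation G 3.
Proof.
move=> lfG [H [_ conH] acyH]; exists (maxclique G), H, (clique_graph_regions H).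
split=> //; split=> [v|u v nuv].
  split; last exact: conH.
  have [||K maxK sK] := @maximal_clique_extension _ _ lfG [set v].
  - exact: clique1.
  - by exists v.
  by exists (exist _ K maxK); exact: sK.
split=> [Guv|[X [Xu Xv]]]; last by apply: (@maxclique_clique _ G X).
have [||K maxK sK] := @maximal_clique_extension _ _ lfG [set u; v].
- exact: clique2.
- by exists u; left.
by exists (exist _ K maxK); split; apply: sK; [left | right].
Qed.

(** * Construction of a canonical acyclic representation *)

Section CentralGraph.
Variables (T : Type) (G : graph T).
Hypothesis lfG : locally_finite G.
Hypothesis lcG : locally_chordal 3 G.
Implicit Types (S A K : set T).

Definition clique_node := {S : set T | clique G S /\ S !=set0}.

Definition node_label (u : clique_node) : set T := sval u.

Lemma node_label_inj u w : node_label u = node_label w -> u = w.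
Proof. by apply: eq_sig_hprop => ? ? ?; exact: Prop_irrelevance. Qed.

Lemma node_clique u : clique G (node_label u).
Proof. by have [] := svalP u. Qed.

Lemma node_nonempty u : node_label u !=set0.
Proof. by have [] := svalP u. Qed.

(** The edges [u w] of the star of the clique [S] that labels [u]; here the
    centre of the star is the node [u] alone, whose piece is empty. *)
Definition rises (u w : clique_node) := exists2 x, link G (node_label u) x &
  node_label w = node_label u `|` center G (link_component G (node_label u) x).

Definition central_adj u w := rises u w \/ rises w u.

Lemma link_component_sub S x : link G S x -> link_component G S x `<=` link G S.
Proof. by move=> Lx y rxy; exact: reach_in_mem rxy Lx. Qed.

Lemma link_component_connected S x y z : link G S x ->
  link_component G S x y -> link_component G S x z ->
  reach_in G (link_component G S x) y z.
Proof.
move=> Lx rxy rxz; have [n] := reach_trans (reach_in_sym rxy) rxz.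
elim: n y rxy => [|n IHn] y rxy /=; first by move->; exact: reach_refl.
case=> t [Ly Lt Gyt] wtz; have rxt : link_component G S x t.
  by apply: (reach_trans rxy); exact: reach_step.
by apply: reach_trans (IHn t rxt wtz); exact: reach_step.
Qed.

Lemma component_center S x : S !=set0 -> link G S x ->
  [/\ center G (link_component G S x) !=set0, clique G (center G (link_component G S x)) &
      center G (link_component G S x) `<=` link_component G S x].
Proof.
move=> S0 Lx; have sAL := link_component_sub Lx; split; last exact: center_sub.
- apply: center_nonempty.
  + by apply: sub_finite_set sAL _; exact: finite_link.
  + by apply: sub_chordal sAL _; exact: link_chordal.
  + by exists x; exact: reach_refl.
- by apply: center_clique => y z; exact: link_component_connected.
Qed.

Lemma clique_center S x : clique G S -> S !=set0 -> link G S x ->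
  clique G (S `|` center G (link_component G S x)).
Proof.
move=> clS S0 Lx; have [_ clc sc] := component_center S0 Lx.
have Lc y : center G (link_component G S x) y -> link G S y.
  by move=> /sc; exact: link_component_sub.
move=> y z [Sy|cy] [Sz|cz] nyz; first exact: clS.
- by apply: Lc cz _ Sy.
- by apply: adj_sym; apply: Lc cy _ Sz.
- exact: clc.
Qed.

Lemma rises_strict u w : rises u w ->
  node_label u `<=` node_label w /\ exists2 y, node_label w y & link G (node_label u) y.
Proof.
move=> [x Lx ->]; split; first by move=> y; left.
have [[y cy] _ sc] := component_center (node_nonempty u) Lx.
by exists y; [right | exact/(link_component_sub Lx)/sc].
Qed.

Lemma central_adj_sym u w : central_adj u w -> central_adj w u.
Proof. by move=> /or_comm. Qed.

Lemma central_adj_irr u : ~ central_adj u u.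
Proof. by move=> [|] /rises_strict[_ [y uy Ly]]; exact: link_notin Ly uy. Qed.

Definition central_graph : graph clique_node := Graph central_adj_sym central_adj_irr.

Lemma rises_pieces u w S : rises u w -> node_label u = S ->
  [/\ piece G node_label S u = set0, piece G node_label S w !=set0 &
    node_label w = S `|` center G (piece G node_label S w)].
Proof.
move=> [x Lx wE] uS; rewrite uS in Lx wE.
have S0 : S !=set0 by rewrite -uS; exact: node_nonempty.
have [[y cy] _ sc] := component_center S0 Lx.
have abw : above node_label S w by rewrite /above /= wE => z; left.
have wy : node_label w y by rewrite wE; right.
have nSy : ~ S y by exact/link_notin/(link_component_sub Lx)/sc.
have pw : piece G node_label S w = link_component G S x.
  rewrite (piece_component node_clique abw wy nSy).
  exact/esym/link_component_eq/sc.
split.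
- by apply/seteqP; split=> // z [t []]; rewrite uS.
- by exists y; exact: piece_mem.
- by rewrite pw.
Qed.

Lemma central_star S : clique G S -> S !=set0 -> star_at G central_graph node_label S.
Proof.
move=> clS S0; exists set0.
have lower u w : rises u w -> node_label u `&` node_label w = S -> node_label u = S.
  by move=> /rises_strict[suw _] <-; apply/esym/setIidPl.
split.
- move=> u w [ruw|rwu] uwS.
    have [-> [y py] _] := rises_pieces ruw (lower _ _ ruw uwS).
    by split; [move=> p0; rewrite -p0 in py | left].
  rewrite setIC in uwS.
  have [-> [y py] _] := rises_pieces rwu (lower _ _ rwu uwS).
  by split; [move=> p0; rewrite p0 in py | right].
- move=> u abu pu0; have [y [x [ux nSx _]]] : piece G node_label S u !=set0.
    by apply: contrapT => no; apply: pu0; apply/seteqP; split=> // y py; case: no; exists y.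
  have Lx := clique_link (@node_clique u) abu ux nSx.
  have clw := clique_center clS S0 Lx.
  have w0 : S `|` center G (link_component G S x) !=set0.
    by have [s Ss] := S0; exists s; left.
  pose v : clique_node := exist _ S (conj clS S0).
  pose w : clique_node := exist _ _ (conj clw w0).
  have rvw : rises v w by exists x.
  have [pv _ _] := rises_pieces rvw erefl.
  have [[z cz] _ sc] := component_center S0 Lx.
  have abw : above node_label S w by move=> t; left.
  exists w, v; split=> //; first by right.
  rewrite (piece_component node_clique abu ux nSx).
  have wz : node_label w z by right.
  have nSz : ~ S z by exact/link_notin/(link_component_sub Lx)/sc.
  rewrite (piece_component node_clique abw wz nSz).
  exact/esym/link_component_eq/sc.
- suff edge u w : above node_label S u -> above node_label S w -> central_adj u w ->
      piece G node_label S u = set0 -> piece G node_label S w <> set0 ->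
      node_label u = S /\ node_label w = S `|` center G (piece G node_label S w).
    move=> u w u' w' abu abw abu' abw' uw uw' pu pu' pw pww'.
    have pw' : piece G node_label S w' <> set0 by rewrite -pww'.
    have [uE wE] := edge u w abu abw uw pu pw.
    have [uE' wE'] := edge u' w' abu' abw' uw' pu' pw'.
    by split; apply: node_label_inj; rewrite ?uE ?uE' // wE wE' pww'.
  move=> abu abw uw pu pw; have uS := piece_eq0 abu pu.
  case: uw => [ruw|/rises_strict[_ [y uy Ly]]].
    by have [_ _] := rises_pieces ruw uS.
  by rewrite uS in uy; case: (link_notin Ly); exact: abw.
- by move=> u w uS wS; apply: node_label_inj; rewrite uS.
Qed.

End CentralGraph.

(** * Equivariance *)

Section Equivariance.
Variables (T : Type) (G : graph T).
Implicit Types (g : aut G) (S A : set T).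

Lemma aut_inj g : injective g.
Proof. exact/bij_inj/aut_bij. Qed.

Lemma aut_surj g y : exists x, g x = y.
Proof. by have [h _ hK] := aut_bij g; exists (h y). Qed.

Lemma aut_inverse g : exists h : aut G, cancel g h /\ cancel h g.
Proof.
have [h gK hK] := aut_bij g.
have adjh x y : G (h x) (h y) <-> G x y by rewrite -(aut_adj g) !hK.
by exists (Aut (Bijective hK gK) adjh).
Qed.

Lemma mem_aut_image g A x : (g @` A) (g x) <-> A x.
Proof. by split=> [[y Ay /aut_inj <-]|Ax]; [|exists x]. Qed.

Lemma aut_imageP g A B : (forall x, B (g x) <-> A x) -> B = g @` A.
Proof.
move=> BA; apply/seteqP; split=> y; have [x <-] := aut_surj g y.
  by move=> /BA Ax; exact/mem_aut_image.
by move/mem_aut_image/BA.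
Qed.

Lemma aut_image_inj g A B : g @` A = g @` B -> A = B.
Proof.
move=> gAB; apply/seteqP; split=> x /(mem_aut_image g).
  by rewrite gAB => /mem_aut_image.
by rewrite -gAB => /mem_aut_image.
Qed.

Lemma clique_aut g S : clique G S -> clique G (g @` S).
Proof.
move=> clS _ _ [x Sx <-] [y Sy <-] nxy; apply/aut_adj/clS => // xy.
by apply: nxy; rewrite xy.
Qed.

Lemma link_aut g S : link G (g @` S) = g @` link G S.
Proof.
apply: aut_imageP => x; split=> [Lx s Ss|Lx _ [s Ss <-]].
  by apply/(aut_adj g); apply: Lx; exists s.
by apply/aut_adj; exact: Lx.
Qed.

Lemma reach_in_aut g A x y : reach_in G (g @` A) (g x) (g y) <-> reach_in G A x y.
Proof.
split=> -[n]; elim: n x => [|n IHn] x /=.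
- by move=> /aut_inj ->; exact: reach_refl.
- case=> _ [/mem_aut_image Ax [z Az <-] /aut_adj Gxz] /IHn.
  by apply: reach_trans; exact: reach_step.
- by move=> ->; exact: reach_refl.
- case=> z [Ax Az Gxz] /IHn; apply: reach_trans; apply: reach_step.
  by split; [exact/mem_aut_image | exact/mem_aut_image | exact/aut_adj].
Qed.

Lemma link_component_aut g S x :
  link_component G (g @` S) (g x) = g @` link_component G S x.
Proof.
by apply: aut_imageP => y; rewrite /link_component /= link_aut; exact: reach_in_aut.
Qed.

Lemma simplicial_aut g A : simplicial G (g @` A) = g @` simplicial G A.
Proof.
apply: aut_imageP => x; split=> -[].
  move=> /mem_aut_image Ax cl; split=> // y z [Ay Gxy] [Az Gxz] nyz.
  apply/(aut_adj g); apply: cl; try by move=> /aut_inj.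
    by split; [exact/mem_aut_image | exact/aut_adj].
  by split; [exact/mem_aut_image | exact/aut_adj].
move=> Ax cl; split; first exact/mem_aut_image.
move=> _ _ [[y Ay <-] /aut_adj Gxy] [[z Az <-] /aut_adj Gxz] nyz.
by apply/aut_adj/cl => // yz; apply: nyz; rewrite yz.
Qed.

Lemma peel_aut g k A : peel G k (g @` A) = g @` peel G k A.
Proof.
elim: k => [//|k IHk]; rewrite /peel !iterS -!/(peel G k _) IHk simplicial_aut.
apply: aut_imageP => x; split=> -[Bx nsx]; split.
- by move/mem_aut_image: Bx.
- by move=> sx; apply: nsx; exact/mem_aut_image.
- exact/mem_aut_image.
- by move/mem_aut_image.
Qed.

Lemma center_aut g A : center G (g @` A) = g @` center G A.
Proof.
apply: aut_imageP => x; split=> -[k [pk pSk]]; exists k.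
  rewrite peel_aut in pk; rewrite peel_aut in pSk.
  split; first by move/mem_aut_image: pk.
  by apply: (@aut_image_inj g); rewrite pSk image_set0.
by rewrite !peel_aut pSk image_set0; split=> //; exact/mem_aut_image.
Qed.

Lemma subgraph_eq (U : Type) (H : graph U) (S1 S2 : subgraph H) :
  sverts S1 = sverts S2 -> sedge S1 = sedge S2 -> S1 = S2.
Proof.
case: S1 S2 => [v1 e1 ? ? ?] [v2 e2 ? ? ?] /= vE eE; subst v2 e2.
by congr Subgraph; exact: Prop_irrelevance.
Qed.

Hypothesis lfG : locally_finite G.
Hypothesis lcG : locally_chordal 3 G.

Let H := central_graph lfG lcG.

Lemma aut_node_subproof g (u : clique_node G) :
  clique G (g @` node_label u) /\ g @` node_label u !=set0.
Proof.
split; first exact/clique_aut/node_clique.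
by have [x ux] := node_nonempty u; exists (g x); exists x.
Qed.

Definition aut_node g (u : clique_node G) : clique_node G :=
  exist _ _ (aut_node_subproof g u).

Lemma aut_node_bij g : bijective (aut_node g).
Proof.
have [h [gK hK]] := aut_inverse g; exists (aut_node h) => u.
  by apply: node_label_inj; rewrite /= image_comp (eq_image_id (g := h \o g)) // => x _; exact: gK.
by apply: node_label_inj; rewrite /= image_comp (eq_image_id (g := g \o h)) // => x _; exact: hK.
Qed.

Lemma rises_aut g u w : rises (aut_node g u) (aut_node g w) <-> rises u w.
Proof.
split=> -[x Lx wE].
  have [y yx] := aut_surj g x; rewrite -yx /= link_aut in Lx.
  exists y; first exact/(mem_aut_image g).
  by apply: (aut_image_inj (g := g)); rewrite image_setU -center_aut -link_component_aut yx.
exists (g x); first by rewrite /= link_aut; exact/mem_aut_image.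
by rewrite /= [in LHS]wE image_setU link_component_aut center_aut.
Qed.

Lemma central_adj_aut g u w : H (aut_node g u) (aut_node g w) <-> H u w.
Proof. by rewrite /= /central_adj !rises_aut. Qed.

Definition node_action g : aut H := Aut (aut_node_bij g) (@central_adj_aut g).

Lemma node_action_is_action : is_action node_action.
Proof.
split=> [u|g h u]; apply: node_label_inj; rewrite /= ?image_id //.
by rewrite image_comp.
Qed.

Lemma node_action_regions g v :
  image_subgraph (node_action g) (label_regions H (@node_label _ G) v) =
  label_regions H (@node_label _ G) (g v).
Proof.
have surj u : exists u', node_action g u' = u.
  by have [k _ kK] := aut_node_bij g; exists (k u); exact: kK.
apply: subgraph_eq.
  apply/seteqP; split=> [_ [u uv <-]|u]; first by exists v.
  have [u' <-] := surj u; move=> /mem_aut_image uv.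
  by exists u'.
apply/funext => x; apply/funext => y; apply/propext; split.
  case=> a [b [[av bv Hab] <- <-]]; split; try exact/mem_aut_image.
  exact/central_adj_aut.
have [[a <-] [b <-]] := (surj x, surj y).
move=> [/mem_aut_image av /mem_aut_image bv /central_adj_aut Hab].
by exists a, b.
Qed.

End Equivariance.

Lemma locally_chordal_acyclic_canonical (T : Type) (G : graph T) :
  locally_finite G -> locally_chordal 3 G -> has_acyclic_canonical_representation G 3.
Proof.
move=> lfG lcG; pose H := central_graph lfG lcG; pose l := @node_label _ G.
have cover S : clique G S -> S !=set0 -> above l S !=set0.
  by move=> clS S0; exists (exist _ S (conj clS S0)).
have finlink S : S !=set0 -> finite_set (link G S) by exact: finite_link.
have chlink S : S !=set0 -> chordal (induced G (link G S)) by exact: link_chordal.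
have starH := central_star lfG lcG.
exists (clique_node G), H, (label_regions H l); split.
- exact: (label_region_representation (@node_clique _ G) cover finlink chlink starH).
- exact: (label_acyclic_representation (@node_clique _ G) cover finlink chlink starH).
- exists (node_action lfG lcG); first exact: node_action_is_action.
  exact: node_action_regions.
Qed.

Theorem theorem4 (V : Type) (G : graph V) (G_lf : locally_finite G) :
  (locally_chordal 3 G <-> wheel_free G) /\
  (locally_chordal 3 G <-> has_acyclic_clique_graph G 3) /\
  (locally_chordal 3 G <-> has_acyclic_canonical_representation G 3) /\
  (locally_chordal 3 G <-> has_acyclic_representation G 3).
Proof.
have canon_repr : has_acyclic_canonical_representation G 3 -> has_acyclic_representation G 3.
  by move=> [U [H [R [repR acyR _]]]]; exists U, H, R.
have repr_lc : has_acyclic_representation G 3 -> locally_chordal 3 G.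
  move=> [U [H [R [repR acyR]]]]; apply: wheel_free_locally_chordal.
  exact: representation_wheel_free repR acyR.
have lc_canon := locally_chordal_acyclic_canonical G_lf.
split; [|split; [|split]]; split=> //.
- exact: locally_chordal_wheel_free.
- exact: wheel_free_locally_chordal.
- exact: locally_chordal_acyclic_clique_graph.
- by move=> cg; exact/repr_lc/clique_graph_representation.
- by move=> /canon_repr.
- by move=> /lc_canon/canon_repr.
Qed.
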